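(* Let $p\ge 1$ and $n_1,\ldots,n_p$ be positive integers, $N=n_1\cdots n_p$, and $k$ a positive integer. Then: (a) $\Sigma^k(n_1,\ldots,n_p)$ is a connected, compact subset of $\Sigma(n_1,\ldots,n_p)$. In particular, if $\Sigma^k(n_1,\ldots,n_p)\neq\Sigma(n_1,\ldots,n_p)$, then it is not dense in $\Sigma(n_1,\ldots,n_p)$ and its complement in $\Sigma(n_1,\ldots,n_p)$ is (relatively) open. (b) If $k<\dfrac{n_1^2\cdots n_p^2}{1-p+\sum_{j=1}^p n_j^2}$, then $\Sigma^k(n_1,\ldots,n_p)$ has measure $0$ in $\Sigma(n_1,\ldots,n_p)$. (c) If $n_1\le n_2\le\cdots\le n_p$ and $k\ge n_1^2\cdots n_{p-1}^2$, then $\Sigma^k(n_1,\ldots,n_p)$ has positive measure in $\Sigma(n_1,\ldots,n_p)$, and in fact contains a nonempty open subset.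
   Context: For a positive integer $w$, a density matrix on $\mathbb{C}^w$ is a $w\times w$ complex Hermitian positive semi-definite matrix of trace $1$; let $\mathcal{DM}(w)$ denote the set of these. Let $N=n_1\cdots n_p$ and identify $\mathbb{C}^N=\mathbb{C}^{n_1}\otimes\cdots\otimes\mathbb{C}^{n_p}$. A product density matrix is one of the form $A_1\otimes\cdots\otimes A_p$ with $A_i\in\mathcal{DM}(n_i)$. $\Sigma(n_1,\ldots,n_p)\subset\mathcal{DM}(N)$ is the set of separable density matrices, i.e. convex combinations of (finitely many) product density matrices. $\Sigma^k(n_1,\ldots,n_p)$ is the set of $A\in\Sigma(n_1,\ldots,n_p)$ that can be written as a convex combination of at most $k$ product density matrices. Measure is $(N^2-1)$-dimensional Lebesgue measure on the real affine hyperplane $\tau_1(N)$ of $N\times N$ complex Hermitian matrices of trace $1$ (which contains $\Sigma(n_1,\ldots,n_p)$); ''open'' means open in $\tau_1(N)$ (resp. relatively open in $\Sigma(n_1,\ldots,n_p)$ where stated). *)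

(* Defs.v *)
From HB Require Import structures.
From mathcomp Require Import all_boot all_order all_algebra.
From mathcomp Require Import all_classical all_reals all_analysis.
From mathcomp Require Import complex.
Import Order.TTheory GRing.Theory Num.Theory.
Import numFieldTopology.Exports numFieldNormedType.Exports.


Local Open Scope ring_scope.
Local Open Scope classical_set_scope.

(* The complex numbers R[i] carry the topology induced by their modulus
   (this is the canonical numField topology, copied onto the concrete type
   so that matrices 'M[R[i]]_(m,n) get their usual (normed) topology). *)
HB.instance Definition _ (R : rcfType) := PseudoPointedMetric.copy R[i] (R[i])^o.

Definition realC {R : rcfType} (x : R) : R[i] := Complex x 0.

Section DensityMatrices.
Variable R : realType.
Local Notation C := R[i].

Definition hermitian {w : nat} (A : 'M[C]_w) : Prop :=
  forall i j, A j i = (A i j)^*.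

Definition psd {w : nat} (A : 'M[C]_w) : Prop :=
  forall v : 'cV[C]_w, 0 <= \sum_i \sum_j (v i ord0)^* * A i j * v j ord0.

Definition tau1 (w : nat) : set 'M[C]_w :=
  [set A | hermitian A /\ \tr A = 1].

Definition density (w : nat) : set 'M[C]_w :=
  [set A | hermitian A /\ psd A /\ \tr A = 1].

(* Index set of the standard basis of C^{n_1} (x) ... (x) C^{n_p}:
   tuples (i_1,...,i_p) with i_j < n_j. *)
Definition tidx {p : nat} (n : 'I_p -> nat) : finType :=
  {dffun forall j : 'I_p, 'I_(n j)}.

(* N = n_1 ... n_p, realised as the cardinality of the tuple index set
   (which equals \prod_j n j); C^N is identified with the tensor product
   through the bijection enum_val : 'I_N -> tidx n. *)
Definition Ndim {p : nat} (n : 'I_p -> nat) : nat := #|tidx n|.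

Definition tensor_mx {p : nat} {n : 'I_p -> nat}
    (A : forall j : 'I_p, 'M[C]_(n j)) : 'M[C]_(Ndim n) :=
  \matrix_(a, b) \prod_(j : 'I_p)
      A j (@enum_val (tidx n) predT a j) (@enum_val (tidx n) predT b j).

Definition product_dm {p : nat} (n : 'I_p -> nat) : set 'M[C]_(Ndim n) :=
  [set M | exists A : forall j : 'I_p, 'M[C]_(n j),
             (forall j, density (n j) (A j)) /\ M = tensor_mx A].

Definition convex_comb_prod {p : nat} (n : 'I_p -> nat) (m : nat)
    (M : 'M[C]_(Ndim n)) : Prop :=
  exists (w : 'I_m -> R) (P : 'I_m -> 'M[C]_(Ndim n)),
    (forall l, 0 <= w l) /\ \sum_l w l = 1 /\
    (forall l, product_dm n (P l)) /\
    M = \sum_l realC (w l) *: P l.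

Definition Sigma {p : nat} (n : 'I_p -> nat) : set 'M[C]_(Ndim n) :=
  [set M | exists m : nat, convex_comb_prod n m M].

Definition Sigma_k {p : nat} (n : 'I_p -> nat) (k : nat) : set 'M[C]_(Ndim n) :=
  [set M | exists m : nat, (m <= k)%N /\ convex_comb_prod n m M].

Definition lebesgue_null {d : nat} (E : set 'rV[R]_d) : Prop :=
  forall eps : R, 0 < eps ->
    exists a b : nat -> 'rV[R]_d,
      (forall l i, a l ord0 i <= b l ord0 i) /\
      (E `<=` \bigcup_l [set x | forall i, a l ord0 i <= x ord0 i <= b l ord0 i]) /\
      (forall m, \sum_(l < m) \prod_i (b l ord0 i - a l ord0 i) <= eps).

Definition tau1_chart {w : nat} (phi : 'rV[R]_(w * w - 1) -> 'M[C]_w) : Prop :=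
  (exists (M0 : 'M[C]_w) (E : 'I_(w * w - 1) -> 'M[C]_w),
      forall x, phi x = M0 + \sum_i realC (x ord0 i) *: E i) /\
  injective phi /\ phi @` setT = tau1 w.

Definition tau1_null {w : nat} (S : set 'M[C]_w) : Prop :=
  forall phi, tau1_chart phi -> lebesgue_null (phi @^-1` S).

Definition tau1_positive {w : nat} (S : set 'M[C]_w) : Prop :=
  forall phi, tau1_chart phi -> ~ lebesgue_null (phi @^-1` S).

Definition tau1_open {w : nat} (U : set 'M[C]_w) : Prop :=
  exists V : set 'M[C]_w, open V /\ U = tau1 w `&` V.

End DensityMatrices.

(* Main.v *)
(* (a), (b): a Hermitian w x w matrix of trace 1 has w^2 - 1 free real
   coordinates, so mixtures of k product states are a polynomial image of a
   compact convex set of parameters inside the unit cube of dimension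
   k - 1 + k * sum_j (n_j^2 - 1).  Compactness and connectedness pass to the
   image; under the hypothesis of (b) that dimension is less than N^2 - 1, and a
   Lipschitz image of a cube of smaller dimension is null, as one sees by
   cutting the cube into small cubes.
   (c): the n_j^2 pure states e_a, (e_a + e_b)/sqrt 2, (e_a + i e_b)/sqrt 2 span
   the n_j x n_j matrices.  Tensoring them over all factors but the last writes
   any Hermitian M as sum_f B_f (x) S_f(M), with one term per choice f of a pure
   state in each of these factors and S_f(M) Hermitian, linear in M.  Around the
   maximally mixed choice M0 = sum_f B_f (x) kappa I the last factors
   kappa I + S_f(M - M0) stay positive definite, so a neighbourhood of M0 in the
   hyperplane consists of such mixtures.  It has positive measure because
   finitely many boxes covering a cube contain all points of a fine grid. *)
Require Import Defs.
From HB Require Import structures.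
From mathcomp Require Import all_boot all_order all_algebra.
From mathcomp Require Import all_classical all_reals all_analysis.
From mathcomp Require Import complex ring lra.
Import Order.TTheory GRing.Theory Num.Theory.
Import numFieldTopology.Exports numFieldNormedType.Exports.
Local Open Scope ring_scope.
Local Open Scope classical_set_scope.

(** * Null sets: Lipschitz images of low dimension, and cubes *)

Section NullSets.
Set Implicit Arguments.
Variable R : realType.

Definition cube (d : nat) (c : 'rV[R]_d) (s : R) : set 'rV[R]_d :=
  [set x | forall i, c ord0 i <= x ord0 i <= c ord0 i + s].

(** The unit ball of the sup norm; negative values are included because off-diagonal matrix
    coordinates may have either sign. *)
Definition unit_cube (d : nat) : set 'rV[R]_d :=
  [set x | forall i, - 1 <= x ord0 i <= 1].

Lemma lebesgue_null_subset (d : nat) (A B : set 'rV[R]_d) :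
  A `<=` B -> lebesgue_null R B -> lebesgue_null R A.
Proof.
move=> AB nB e /nB[a [b [ab [Bab s]]]]; exists a, b.
by split => //; split => //; apply: subset_trans Bab.
Qed.

Lemma grid_approx (K : nat) (x : R) : (0 < K)%N -> - 1 <= x <= 1 ->
  exists i : 'I_K, `|x - (- 1 + 2 * i%:R / K%:R)| <= 2 / K%:R.
Proof.
move=> K0 /andP[x1 x2]; have K0' : 0 < K%:R :> R by rewrite ltr0n.
pose y : R := K%:R * (x + 1) / 2.
have y0 : 0 <= y by rewrite /y; apply: divr_ge0 => //; apply: mulr_ge0; lra.
have yE : x = -1 + 2 * y / K%:R by rewrite /y; field; rewrite gt_eqF.
have /andP[t1 t2] := truncn_itv y0.
have yK : y <= K%:R.
  by rewrite /y ler_pdivrMr // ler_wpM2l ?(ltW K0') //; lra.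
set t := Num.Def.trunc y in t1 t2.
suff [i Hi] : exists i : 'I_K, `|y - i%:R| <= 1.
  exists i; rewrite yE (_ : _ - _ = (2 / K%:R) * (y - i%:R)); last by ring.
  have K2 : 0 <= 2 / K%:R :> R by rewrite divr_ge0 // ltW.
  by rewrite normrM ger0_norm // -[leRHS]mulr1 ler_wpM2l.
have [tK|tK] := ltnP t K.
  exists (Ordinal tK) => /=; rewrite -natr1 in t2; rewrite ler_norml; lra.
(* Only the endpoint [x = 1] reaches this case; the last grid index is then exactly one step
   away. *)
have K1 : (K.-1 < K)%N by rewrite prednK.
exists (Ordinal K1) => /=.
have -> : K.-1%:R = K%:R - 1 :> R by rewrite -subn1 natrB.
have tK' : K%:R <= t%:R :> R by rewrite ler_nat.
by rewrite ler_norml; lra.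
Qed.

(** The cube is cut into K^d cells of side 2/K. The image of each lies in a box of side 4M/K, so the
    total volume is at most (4M)^D K^(d-D), hence at most (4M)^D / K. *)
Lemma lipschitz_image_null (d D : nat) (g : 'rV[R]_d -> 'rV[R]_D) (L : R) :
  (d < D)%N ->
  (forall x y (h : R), 0 <= h -> unit_cube x -> unit_cube y ->
     (forall i, `|x ord0 i - y ord0 i| <= h) ->
     forall j, `|g x ord0 j - g y ord0 j| <= L * h) ->
  lebesgue_null R (g @` unit_cube (d:=d)).
Proof.
move=> dD gL e e0.
(* [L] may be zero or negative; [M] is a positive Lipschitz constant. *)
pose M := Num.max L 1.
have M1 : 1 <= M by rewrite le_max lexx orbT.
have M0 : 0 < M by apply: lt_le_trans M1.
have LM : L <= M by rewrite le_max lexx.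
pose V := (4 * M) ^+ D.
have V0 : 0 < V by rewrite exprn_gt0 // mulr_gt0.
pose K := (Num.Def.trunc (V / e)).+1.
have K0 : 0 < K%:R :> R by rewrite ltr0n.
have VK : V / K%:R <= e.
  rewrite ler_pdivrMr // mulrC -ler_pdivrMr // ltW //.
  exact: truncnS_gt.
pose T : finType := {ffun 'I_d -> 'I_K}.
pose c (f : T) : 'rV[R]_d := \row_i (- 1 + 2 * (f i)%:R / K%:R).
have c01 f : unit_cube (c f).
  move=> i; rewrite !mxE.
  have fi : (f i)%:R <= K%:R :> R by rewrite ler_nat ltnW.
  have : 0 <= (f i)%:R / K%:R :> R by rewrite divr_ge0 // ltW.
  have : (f i)%:R / K%:R <= 1 :> R by rewrite ler_pdivrMr // mul1r.
  by rewrite -mulrA; lra.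
pose r : R := 2 * M / K%:R.
have r0 : 0 <= r by rewrite divr_ge0 ?mulr_ge0 // ltW.
(* [s = -1] and [s = 1] give opposite corners of the box around the image of the [l]-th grid point.
   Past the last grid point the box degenerates to the origin. *)
pose bx (s : R) (l : nat) : 'rV[R]_D :=
  if insub l : option 'I_#|T| is Some o
  then \row_j (g (c (enum_val o)) ord0 j + s * r) else 0.
exists (bx (- 1)), (bx 1); split; last split.
- move=> l j; rewrite /bx; case: insub => [u|]; rewrite ?mxE //; lra.
- move=> _ [x xc <-].
  have /fin_all_exists[f Hf] : forall i : 'I_d, exists k : 'I_K,
      `|x ord0 i - (- 1 + 2 * k%:R / K%:R)| <= 2 / K%:R.
    by move=> i; apply: grid_approx => //; exact: xc.
  pose o : 'I_#|T| := enum_rank ([ffun i => f i] : T).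
  exists (nat_of_ord o) => // j; rewrite /bx valK.
  rewrite /o enum_rankK !mxE.
  have : `|g x ord0 j - g (c [ffun i => f i]) ord0 j| <= L * (2 / K%:R).
    by apply: gL => // i; rewrite mxE ffunE.
  have : L * (2 / K%:R) <= r.
    rewrite (_ : r = M * (2 / K%:R)); last by rewrite /r; ring.
    by rewrite ler_wpM2r // divr_ge0 // ltW.
  move=> h1 h2; have := le_trans h2 h1; rewrite ler_norml; lra.
- move=> m; pose v := (2 * r) ^+ D.
  have v0 : 0 <= v by rewrite exprn_ge0 // mulr_ge0.
  have -> : \sum_(l < m) \prod_i (bx 1 l ord0 i - bx (-1) l ord0 i)
      = v *+ minn m #|T|.
    elim: m => [|m IH]; first by rewrite big_ord0 min0n mulr0n.
    rewrite big_ord_recr /= IH /bx; case: insubP => [u oT om|mT].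
      rewrite (minn_idPl _) ?(minn_idPl _) // ?(ltnW oT) //.
      rewrite mulrSr; congr (_ + _).
      rewrite (eq_bigr (fun=> 2 * r)) ?prodr_const ?card_ord // => j _.
      by rewrite !mxE; ring.
    rewrite -leqNgt in mT; rewrite (minn_idPr _) // (minn_idPr _) ?leqW //.
    (* A degenerate box has volume 0 only in positive dimension, since an empty product is 1. *)
    have D0 : (0 < D)%N by exact: leq_ltn_trans dD.
    by rewrite (bigD1 (Ordinal D0)) //= !mxE subr0 mul0r addr0.
  apply: (@le_trans _ _ (v *+ #|T|)); first by rewrite -subr_ge0 -mulrnBr ?geq_minr // mulrn_wge0.
  apply: le_trans VK; rewrite card_ffun !card_ord /v /r /V.
  rewrite (_ : 2 * (2 * M / K%:R) = 4 * M / K%:R); last by ring.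
  rewrite expr_div_n -mulr_natr natrX.
  rewrite -mulrA ler_wpM2l //; first by rewrite exprn_ge0 // mulr_ge0 // ltW.
  rewrite ler_pdivrMl ?exprn_gt0 // ler_pdivlMr // -exprSr.
  by rewrite ler_weXn2l // ler1n.
Qed.

Lemma poly_le_near0 (q : {poly R}) (e : R) : q.[0] < e ->
  exists2 h : R, 0 < h & forall t, 0 <= t <= h -> q.[t] < e.
Proof.
move=> qe; have : \forall t \near (0 : R), q.[t] < e.
  exact: (cvgr_lt _ (@continuous_horner R q 0)).
move=> /nbhs_ballP[h /= h0 H].
exists (h / 2); first by rewrite divr_gt0.
move=> t /andP[t0 th]; apply: H; rewrite /ball /= sub0r normrN ger0_norm //.
by lra.
Qed.

(** Volume of a box with sides [v i] all lengthened by t, as a polynomial in t; its continuity at 0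
    makes small enlargements cheap. *)
Definition side_poly (d : nat) (v : 'I_d -> R) : {poly R} :=
  \prod_i ('X + (v i)%:P).

Lemma horner_side_poly d (v : 'I_d -> R) t :
  (side_poly v).[t] = \prod_i (v i + t).
Proof.
rewrite /side_poly horner_prod; apply: eq_bigr => i _.
by rewrite !hornerE addrC.
Qed.

(** The indices counted lie between the least one u and the greatest one v, and the corresponding
    grid points are (v - u)s/K apart, at most b - a. *)
Lemma card_grid_segment (K : nat) (c s a b : R) : 0 < s -> a <= b ->
  #|[pred i : 'I_K | a <= c + s * i%:R / K%:R <= b]|%:R
    <= K%:R * (b - a) / s + 1.
Proof.
move=> s0 ab; set P := [pred i : 'I_K | _].
have [i0 Pi0|P0] := pickP P; last first.
  rewrite eq_card0 // addr_ge0 // divr_ge0 ?(ltW s0) //.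
  by rewrite mulr_ge0 // subr_ge0.
have K0 : 0 < K%:R :> R by rewrite ltr0n; case: (K) i0 {Pi0} => // -[].
have [u Pu umin] := arg_minnP (fun i : 'I_K => nat_of_ord i) Pi0.
have [v Pv vmax] := arg_maxnP (fun i : 'I_K => nat_of_ord i) Pi0.
have le1 : (#|P| <= (v - u).+1)%N.
  rewrite -(size_iota u (v - u).+1) cardE -(size_map val).
  apply: uniq_leq_size; first by rewrite map_inj_uniq ?enum_uniq //; exact: val_inj.
  move=> _ /mapP[i + ->]; rewrite mem_enum => Pi; rewrite mem_iota umin //=.
  by rewrite addnS ltnS subnKC ?umin //; exact: vmax.
have uv : (u <= v)%N by exact: umin.
apply: (@le_trans _ _ ((v - u).+1%:R)); first by rewrite ler_nat.
rewrite -natr1 natrB // lerD2r.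
move: Pu Pv; rewrite !inE => /andP[ua ub] /andP[va vb].
rewrite ler_pdivlMr //.
have -> : (v%:R - u%:R) * s = K%:R * ((c + s * v%:R / K%:R) - (c + s * u%:R / K%:R)).
  by field; rewrite gt_eqF.
rewrite ler_wpM2l ?(ltW K0) //; lra.
Qed.

(** Counting replaces integration: all K^d grid points of the cube are covered, and each box holds
    at most the product of the numbers K(b-a)/s + 1. Multiplying by (s/K)^d and taking K large gives
    the bound. *)
Lemma finite_cover_volume (d m : nat) (c : 'rV[R]_d) (s : R)
    (a b : 'I_m -> 'rV[R]_d) : 0 < s ->
  (forall l i, a l ord0 i <= b l ord0 i) ->
  (forall x, cube c s x -> exists l, forall i, a l ord0 i <= x ord0 i <= b l ord0 i) ->
  s ^+ d <= \sum_l \prod_i (b l ord0 i - a l ord0 i).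
Proof.
move=> s0 ab cov.
(* The count yields s^d <= q(s/K); were q(0) < s^d, continuity would contradict this for large K. *)
pose q : {poly R} := \sum_l side_poly (fun i => b l ord0 i - a l ord0 i).
have qE t : q.[t] = \sum_l \prod_i (b l ord0 i - a l ord0 i + t).
  by rewrite horner_sum; apply: eq_bigr => l _; rewrite horner_side_poly.
have -> : \sum_l \prod_i (b l ord0 i - a l ord0 i) = q.[0].
  by rewrite qE; apply: eq_bigr => l _; apply: eq_bigr => i _; rewrite addr0.
rewrite leNgt; apply/negP => /poly_le_near0[h h0 qh].
pose K := (Num.Def.trunc (s / h)).+1.
have K0 : 0 < K%:R :> R by rewrite ltr0n.
have sK : 0 <= s / K%:R <= h.
  rewrite divr_ge0 ?(ltW s0) ?(ltW K0) //= ler_pdivrMr // mulrC -ler_pdivrMr // ltW //.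
  exact: truncnS_gt.
have := qh _ sK; rewrite ltNge => /negP; apply; rewrite qE.
pose T : finType := {ffun 'I_d -> 'I_K}.
pose x (f : T) : 'rV[R]_d := \row_i (c ord0 i + s * (f i)%:R / K%:R).
pose A l i := [pred k : 'I_K | a l ord0 i <= c ord0 i + s * k%:R / K%:R <= b l ord0 i].
have xc f : cube c s (x f).
  move=> i; rewrite !mxE.
  have fi : (f i)%:R <= K%:R :> R by rewrite ler_nat ltnW.
  have h1 : 0 <= s * (f i)%:R / K%:R :> R by rewrite divr_ge0 ?mulr_ge0 ?(ltW s0).
  have h2 : s * (f i)%:R / K%:R <= s :> R by rewrite ler_pdivrMr // ler_wpM2l // ltW.
  by apply/andP; split; lra.
have cardT : (#|T| <= \sum_l #|family (A l)|)%N.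
  apply: (@leq_trans (\sum_(f : T) \sum_l (f \in family (A l)))%N).
    rewrite -sum1_card; apply: leq_sum => f _.
    have [l Hl] := cov _ (xc f).
    rewrite (bigD1 l) //= (_ : f \in family (A l)) //.
    by apply/familyP => i; have := Hl i; rewrite mxE.
  rewrite exchange_big; apply: leq_sum => l _.
  by rewrite -sum1_card [leqRHS]big_mkcond.
have sKd : s ^+ d = (s / K%:R) ^+ d * #|T|%:R.
  rewrite card_ffun !card_ord natrX -exprMn mulrAC mulfK // gt_eqF //.
rewrite sKd; apply: (@le_trans _ _ ((s / K%:R) ^+ d * \sum_l #|family (A l)|%:R)).
  rewrite ler_wpM2l ?exprn_ge0 ?divr_ge0 ?(ltW s0) ?(ltW K0) //.
  by rewrite -natr_sum ler_nat.
rewrite mulr_sumr; apply: ler_sum => l _.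
rewrite card_family foldrE big_image /= natr_prod.
have -> : (s / K%:R) ^+ d = \prod_(i < d) (s / K%:R).
  by rewrite prodr_const card_ord.
rewrite -big_split /=; apply: ler_prod => i _.
have sK0 : 0 <= s / K%:R by case/andP: sK.
rewrite (mulr_ge0 sK0) ?addr_ge0 ?subr_ge0 ?ab //=.
have := @card_grid_segment K (c ord0 i) s _ _ s0 (ab l i).
move=> /(ler_wpM2l (_ : 0 <= s / K%:R)) -/(_ _)/le_trans; apply.
  by rewrite divr_ge0 // ltW.
rewrite mulrDr mulr1 lerD2r.
by rewrite (_ : s / K%:R * _ = b l ord0 i - a l ord0 i) //; field; rewrite !gt_eqF.
Qed.

(** By compactness: the [l]-th box is enlarged to an open one at a cost of at most e/2^(l+1) in
    volume, and a finite subcover would have total volume at most 2e, below s^d = 4e. *)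
Lemma cube_not_null (d : nat) (c : 'rV[R]_d) (s : R) : 0 < s ->
  ~ lebesgue_null R (cube c s).
Proof.
move=> s0 nul; pose e := s ^+ d / 4.
have e0 : 0 < e by rewrite divr_gt0 // exprn_gt0.
have [a [b [ab [cov vol]]]] := nul e e0.
pose len l i := b l ord0 i - a l ord0 i.
have eta_ex l : exists h : R, 0 < h /\
    \prod_i (len l i + h) <= \prod_i len l i + e * 2^-1 ^+ l.+1.
  have : (side_poly (len l)).[0] < \prod_i len l i + e * 2^-1 ^+ l.+1.
    rewrite horner_side_poly (eq_bigr (len l)) => [|i _]; last exact: addr0.
    by rewrite ltrDl mulr_gt0 // exprn_gt0 // invr_gt0.
  move=> /poly_le_near0[h h0 H]; exists h; split => //.
  by rewrite -horner_side_poly ltW // H // lexx ltW.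
have [h Hh] := choice eta_ex.
have h0 l : 0 < h l by have [] := Hh l.
pose O l : set 'rV[R]_d := [set x | forall i,
  a l ord0 i - h l / 2 < x ord0 i < b l ord0 i + h l / 2].
have Oopen l : open (O l).
  rewrite openE => x Ox.
  exists (fun i j => [set y | a l ord0 j - h l / 2 < y < b l ord0 j + h l / 2]).
    move=> i j; rewrite ord1; apply: open_nbhs_nbhs; split; last exact: Ox.
    rewrite (_ : [set _ | _] = `]a l ord0 j - h l / 2, b l ord0 j + h l / 2[%classic).
      exact: itv_open.
    by apply/seteqP; split => y /=; rewrite in_itv.
  by move=> y Hy i; exact: Hy.
have cubeE : cube c s = [set v : 'rV[R]_d | forall i, `[c ord0 i, c ord0 i + s]%classic (v ord0 i)].
  by apply/seteqP; split => x Hx i; have := Hx i; rewrite /= in_itv.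
have : compact (cube c s).
  by rewrite cubeE; apply: (@rV_compact R d (fun i => `[c ord0 i, c ord0 i + s]%classic)) => i; exact: segment_compact.
rewrite compact_cover => /(_ nat setT O (fun l _ => Oopen l)) [].
  move=> x /cov[l _ /= Hl]; exists l => // i.
  by have := Hl i; have := h0 l; move=> ? /andP[? ?]; apply/andP; split; lra.
move=> F _ covF.
(* The finite subcover is replaced by the initial segment of boxes containing it, to which the
   partial-sum bound applies. *)
pose m := (\max_(l <- finmap.enum_fset F) l).+1.
pose a' (l : 'I_m) : 'rV[R]_d := \row_i (a l ord0 i - h l / 2).
pose b' (l : 'I_m) : 'rV[R]_d := \row_i (b l ord0 i + h l / 2).
have /(finite_cover_volume a' b' s0) : forall x, cube c s x ->
    exists l, forall i, a' l ord0 i <= x ord0 i <= b' l ord0 i.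
  move=> x /covF[l /= lF Ol].
  have lm : (l < m)%N by rewrite ltnS (big_rem l) //= leq_maxl.
  exists (Ordinal lm) => i; rewrite !mxE /=.
  by have /andP[? ?] := Ol i; apply/andP; split; exact: ltW.
have a'b' l i : a' l ord0 i <= b' l ord0 i.
  by rewrite !mxE; have := ab l i; have := h0 l; lra.
move=> /(_ a'b'); apply/negP; rewrite -ltNge.
apply: (@le_lt_trans _ _ (\sum_(l < m) (\prod_i len l i + e * 2^-1 ^+ l.+1))).
  apply: ler_sum => l _; have [_ /(le_trans _)-> //] := Hh l.
  rewrite le_eqVlt; apply/orP; left; apply/eqP.
  by apply: eq_bigr => i _; rewrite !mxE /len; field.
rewrite big_split /=.
have geo : \sum_(l < m) e * 2^-1 ^+ l.+1 = e * (1 - 2^-1 ^+ m).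
  elim: (m) => [|k IH]; first by rewrite big_ord0 expr0 subrr mulr0.
  by rewrite big_ord_recr /= IH exprS; field.
have /(_ m) := vol; rewrite -/(len _) geo => volm.
have : e * 2^-1 ^+ m >= 0 by rewrite mulr_ge0 ?exprn_ge0 // ltW.
have eE : s ^+ d = 4 * e by rewrite /e; field.
rewrite mulrBr mulr1 eE => ?.
apply: (@le_lt_trans _ _ (e + e)); last by lra.
by apply: lerD => //; lra.
Qed.

End NullSets.
Arguments cube {R d}.
Arguments unit_cube {R d}.

(** * Polynomial maps: continuity and Lipschitz bounds *)

Section PolynomialMaps.
Set Implicit Arguments.
Variable R : realType.

(** An inductive closure rather than a multivariate polynomial type, so that analytic properties
    follow by structural induction. *)
Inductive polyfun (d : nat) : ('rV[R]_d -> R) -> Prop :=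
| polyfun_cst c : polyfun (fun=> c)
| polyfun_coord i : polyfun (fun x => x ord0 i)
| polyfunD f g : polyfun f -> polyfun g -> polyfun (fun x => f x + g x)
| polyfunM f g : polyfun f -> polyfun g -> polyfun (fun x => f x * g x).

Lemma polyfunN d (f : 'rV[R]_d -> R) : polyfun f -> polyfun (fun x => - f x).
Proof.
move=> fP; rewrite (_ : (fun x => _) = (fun x => -1 * f x)).
  by apply: polyfunM => //; exact: polyfun_cst.
by apply/funext => x; rewrite mulN1r.
Qed.

Lemma polyfun_sum d (I : Type) (r : seq I) (P : pred I) (f : I -> 'rV[R]_d -> R) :
  (forall i, polyfun (f i)) -> polyfun (fun x => \sum_(i <- r | P i) f i x).
Proof.
move=> fP; elim: r => [|i r IH].
  by under eq_fun do rewrite big_nil; exact: polyfun_cst.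
under eq_fun do rewrite big_cons; case: (P i) => //.
exact: polyfunD (fP i) IH.
Qed.

Lemma polyfun_continuous d (f : 'rV[R]_d -> R) : polyfun f -> continuous f.
Proof.
elim=> [c|i|{}f g _ fc _ gc|{}f g _ fc _ gc] x.
- exact: cst_continuous.
- exact: (@coord_continuous R 1 d ord0 i x).
- exact: (@continuousD _ _ _ f g x (fc x) (gc x)).
- exact: (@continuousM _ _ f g x (fc x) (gc x)).
Qed.

(** The sup bound is carried along with the Lipschitz bound because the product case needs both. *)
Lemma polyfun_lipschitz d (f : 'rV[R]_d -> R) : polyfun f ->
  exists2 L : R, 0 <= L & (forall x, unit_cube x -> `|f x| <= L) /\
    (forall x y (h : R), 0 <= h -> unit_cube x -> unit_cube y ->
     (forall i, `|x ord0 i - y ord0 i| <= h) -> `|f x - f y| <= L * h).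
Proof.
elim=> [c|i|{}f g _ [L L0 [fL fl]] _ [M M0 [gM gl]]
  |{}f g _ [L L0 [fL fl]] _ [M M0 [gM gl]]].
- exists `|c| => //; split=> // x y h h0 _ _ _.
  by rewrite subrr normr0 mulr_ge0.
- exists 1 => //; split=> [x /(_ i)|x y h _ _ _ /(_ i)]; rewrite ?mul1r //.
  by rewrite ler_norml.
- exists (L + M); rewrite ?addr_ge0 //; split=> [x xc|x y h h0 xc yc xy].
    by rewrite (le_trans (ler_normD _ _)) // lerD // ?fL ?gM.
  rewrite opprD addrACA mulrDl (le_trans (ler_normD _ _)) //.
  by rewrite lerD // ?fl ?gl.
- exists (L * M + L * M); rewrite ?addr_ge0 ?mulr_ge0 //.
  have LM0 : 0 <= L * M by rewrite mulr_ge0.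
  split=> [x xc|x y h h0 xc yc xy].
    apply: (@le_trans _ _ (L * M)); last by rewrite lerDl.
    by rewrite normrM ler_pM ?fL ?gM.
  have -> : f x * g x - f y * g y = f x * (g x - g y) + (f x - f y) * g y.
    by ring.
  rewrite (_ : (_ + _) * h = L * (M * h) + (L * h) * M); last by ring.
  rewrite (le_trans (ler_normD _ _)) // !normrM.
  by rewrite lerD // ler_pM ?fL ?gM ?fl ?gl.
Qed.

Definition cpolyfun d (f : 'rV[R]_d -> R[i]) : Prop :=
  polyfun (fun x => complex.Re (f x)) /\ polyfun (fun x => complex.Im (f x)).

Lemma cpolyfun_complex d (f g : 'rV[R]_d -> R) :
  polyfun f -> polyfun g -> cpolyfun (fun x => Complex (f x) (g x)).
Proof. by []. Qed.

Lemma cpolyfun_cst d (c : R[i]) : cpolyfun (fun _ : 'rV[R]_d => c).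
Proof. by split; exact: polyfun_cst. Qed.

Lemma cpolyfunD d (f g : 'rV[R]_d -> R[i]) :
  cpolyfun f -> cpolyfun g -> cpolyfun (fun x => f x + g x).
Proof.
move=> [f1 f2] [g1 g2]; split.
  rewrite (_ : (fun x => _) = fun x => complex.Re (f x) + complex.Re (g x)).
    exact: polyfunD.
  by apply/funext => x; case: (f x); case: (g x).
rewrite (_ : (fun x => _) = fun x => complex.Im (f x) + complex.Im (g x)).
  exact: polyfunD.
by apply/funext => x; case: (f x); case: (g x).
Qed.

Lemma cpolyfunM d (f g : 'rV[R]_d -> R[i]) :
  cpolyfun f -> cpolyfun g -> cpolyfun (fun x => f x * g x).
Proof.
move=> [f1 f2] [g1 g2]; split.
  rewrite (_ : (fun x => _) = fun x => complex.Re (f x) * complex.Re (g x) +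
    - (complex.Im (f x) * complex.Im (g x))).
    by apply: polyfunD; [|apply: polyfunN]; exact: polyfunM.
  by apply/funext => x; case: (f x); case: (g x).
rewrite (_ : (fun x => _) = fun x => complex.Re (f x) * complex.Im (g x) +
    complex.Im (f x) * complex.Re (g x)).
  by apply: polyfunD; exact: polyfunM.
by apply/funext => x; case: (f x); case: (g x) => * /=; ring.
Qed.

Lemma cpolyfun_sum d (I : Type) (r : seq I) (f : I -> 'rV[R]_d -> R[i]) :
  (forall i, cpolyfun (f i)) -> cpolyfun (fun x => \sum_(i <- r) f i x).
Proof.
move=> fP; elim: r => [|i r IH].
  by under eq_fun do rewrite big_nil; exact: cpolyfun_cst.
by under eq_fun do rewrite big_cons; exact: cpolyfunD (fP i) IH.
Qed.

Lemma cpolyfun_prod d (I : Type) (r : seq I) (f : I -> 'rV[R]_d -> R[i]) :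
  (forall i, cpolyfun (f i)) -> cpolyfun (fun x => \prod_(i <- r) f i x).
Proof.
move=> fP; elim: r => [|i r IH].
  by under eq_fun do rewrite big_nil; exact: cpolyfun_cst.
by under eq_fun do rewrite big_cons; exact: cpolyfunM (fP i) IH.
Qed.

Lemma ltc_norm (z : R[i]) (e : R) :
  `|complex.Re z| + `|complex.Im z| < e -> `|z| < realC e.
Proof.
move=> h; rewrite normc_def ltcR; apply: le_lt_trans h.
set a := complex.Re z; set b := complex.Im z.
rewrite -[leRHS]ger0_norm ?addr_ge0 // -sqrtr_sqr.
rewrite ler_wsqrtr // sqrrD !real_normK ?num_real //.
by rewrite addrAC lerDl mulrn_wge0 // mulr_ge0.
Qed.

Lemma cpolyfun_continuous d (f : 'rV[R]_d -> R[i]) : cpolyfun f -> continuous f.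
Proof.
move=> [/polyfun_continuous f1 /polyfun_continuous f2] x A.
move=> /nbhs_ballP[e /= e0 eA].
have [r re] : exists r, e = realC r.
  by case: e e0 {eA} => r s; rewrite ltcE /= => /andP[/eqP -> _]; exists r.
have r0 : 0 < r by move: e0; rewrite re ltcE /= => /andP[].
have r2 : 0 < r / 2 by rewrite divr_gt0.
have /cvgrPdist_lt/(_ _ r2) h1 := f1 x.
have /cvgrPdist_lt/(_ _ r2) h2 := f2 x.
suff : \forall y \near x, A (f y) by [].
near=> y; apply: eA; rewrite re /ball /=.
apply: ltc_norm.
have -> : complex.Re (f x - f y) = complex.Re (f x) - complex.Re (f y).
  by case: (f x); case: (f y).
have -> : complex.Im (f x - f y) = complex.Im (f x) - complex.Im (f y).
  by case: (f x); case: (f y).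
rewrite (splitr r) ltrD //.
  by near: y; exact: h1.
by near: y; exact: h2.
Unshelve. all: by end_near. Qed.

Lemma mx_continuous (T : topologicalType) m n (f : T -> 'M[R[i]]_(m, n)) :
  (forall i j, continuous (fun x => f x i j)) -> continuous f.
Proof.
move=> fc x A [P Pf PA].
have : \forall y \near x, forall ij : 'I_m * 'I_n, P ij.1 ij.2 (f y ij.1 ij.2).
  by apply: filter_forall => -[i j]; exact: (fc i j x _ (Pf i j)).
by apply: filterS => y Hy; apply: PA => i j; exact: (Hy (i, j)).
Qed.

End PolynomialMaps.
Arguments polyfun {R d}.
Arguments cpolyfun {R d}.

(** * Real coordinates on Hermitian matrices of trace 1 *)

Section HermitianCoordinates.
Set Implicit Arguments.
Variable R : realType.
Local Notation C := R[i].

Lemma conjcE (z : C) : z^* = Complex (complex.Re z) (- complex.Im z).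
Proof. by case: z. Qed.

Lemma realC_ge0 (x : R) : (0 <= realC x :> C) = (0 <= x).
Proof. by rewrite lecE /= eqxx. Qed.

Lemma realCD (x y : R) : realC (x + y) = realC x + realC y :> C.
Proof. by apply/eqP; rewrite eq_complex /= addr0 !eqxx. Qed.

Lemma realCM (x y : R) : realC (x * y) = realC x * realC y :> C.
Proof. by apply/eqP; rewrite eq_complex /= !mulr0 mul0r subr0 addr0 !eqxx. Qed.

Lemma realCB (x y : R) : realC (x - y) = realC x - realC y :> C.
Proof. by apply/eqP; rewrite eq_complex /= subr0 !eqxx. Qed.

Lemma realC_sum (I : Type) (r : seq I) (P : pred I) (F : I -> R) :
  realC (\sum_(i <- r | P i) F i) = \sum_(i <- r | P i) realC (F i) :> C.
Proof. by apply: (big_morph realC realCD). Qed.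

Lemma ReD (x y : C) : complex.Re (x + y) = complex.Re x + complex.Re y.
Proof. by case: x; case: y. Qed.

Lemma ImD (x y : C) : complex.Im (x + y) = complex.Im x + complex.Im y.
Proof. by case: x; case: y. Qed.

Lemma Re_sum (I : Type) (r : seq I) (P : pred I) (F : I -> C) :
  complex.Re (\sum_(i <- r | P i) F i) = \sum_(i <- r | P i) complex.Re (F i).
Proof. by apply: (big_morph (@complex.Re R) ReD). Qed.

Lemma sum_two (w : nat) (F : 'I_w -> C) (a b : 'I_w) (u : C) :
  \sum_j F j * ((j == a)%:R + u * (j == b)%:R) = F a + F b * u.
Proof.
rewrite (eq_bigr (fun j => (if j == a then F j else 0) +
  (if j == b then F j * u else 0))).
  by rewrite big_split /= -!big_mkcond !big_pred1_eq.
move=> j _; rewrite mulrDr mulrA.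
by do 2!case: eqP => _; rewrite ?mulr1 ?mulr0.
Qed.

(** The quadratic form is evaluated at e_a + u e_b; the case [a = b] is allowed. *)
Lemma psd_two (w : nat) (A : 'M[C]_w) (a b : 'I_w) (u : C) : psd R A ->
  0 <= A a a + A a b * u + (A b a + A b b * u) * u^*.
Proof.
move=> /(_ (\col_j ((j == a)%:R + u * (j == b)%:R))) => h; apply: le_trans h _.
rewrite (eq_bigr (fun i => (A i a + A i b * u) *
   ((i == a)%:R + u^* * (i == b)%:R))) ?sum_two //.
move=> i _; rewrite -sum_two mulr_suml; apply: eq_bigr => j _.
rewrite !mxE rmorphD rmorphM !rmorph_nat; ring.
Qed.

(** Diagonal entries are nonnegative with sum 1. Taking u = 1, -1, i, -i in [psd_two] bounds twice
    the real and imaginary parts of [A a b] by [A a a + A b b]. *)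
Lemma density_entry_bound (w : nat) (A : 'M[C]_w) : density R w A ->
  forall a b, `|complex.Re (A a b)| <= 1 /\ `|complex.Im (A a b)| <= 1.
Proof.
move=> [hA [pA tA]] a b.
have dg0 c : 0 <= A c c.
  by have := psd_two c c 0 pA; rewrite rmorph0 !mulr0 !addr0.
have dg1 c : complex.Re (A c c) <= 1.
  have : A c c <= \tr A by rewrite /mxtrace (bigD1 c) //= lerDl sumr_ge0.
  by rewrite tA lecE => /andP[].
have Re0 (z : C) : 0 <= z -> 0 <= complex.Re z by rewrite lecE => /andP[].
have := Re0 _ (psd_two a b 1 pA); have := Re0 _ (psd_two a b (-1) pA).
have := Re0 _ (psd_two a b (Complex 0 1) pA).
have := Re0 _ (psd_two a b (Complex 0 (-1)) pA).
rewrite !conjcE (hA a b) (conjcE (A a b)).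
have := dg1 a; have := dg1 b.
case: (A a a) => x1 y1; case: (A b b) => x2 y2; case: (A a b) => x y /=.
move=> *; rewrite !ler_norml; split; lra.
Qed.

(** The w^2 real coordinates form a square: real parts of the upper entries above the diagonal,
    their imaginary parts mirrored below it. *)
Definition herm_coord (w : nat) (A : 'M[C]_w) (a b : 'I_w) : R :=
  if a == b then complex.Re (A a a)
  else if (a < b)%N then complex.Re (A a b) else complex.Im (A b a).

Lemma herm_coord_bound (w : nat) (A : 'M[C]_w) a b : density R w A ->
  `|herm_coord A a b| <= 1.
Proof.
move=> dA; rewrite /herm_coord.
by case: ifP => _; [|case: ifP => _]; apply density_entry_bound.
Qed.

(* The diagonal coordinate at [o] is redundant: it is fixed by the trace. *)
Definition herm_of (w : nat) (o : 'I_w) (y : 'I_w -> 'I_w -> R) : 'M[C]_w :=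
  \matrix_(a, b) if a == b
    then realC (if a == o then 1 - \sum_(c | c != o) y c c else y a a)
    else if (a < b)%N then Complex (y a b) (y b a) else Complex (y b a) (- y a b).

Lemma herm_of_hermitian w (o : 'I_w) y : Defs.hermitian R (herm_of o y).
Proof.
move=> a b; rewrite conjcE !mxE eq_sym; case: eqVneq => [->|ab].
  by rewrite oppr0.
case: ltngtP => [h|h|/val_inj h] /=; rewrite ?opprK //.
by rewrite h eqxx in ab.
Qed.

Lemma herm_of_trace w (o : 'I_w) y : \tr (herm_of o y) = 1.
Proof.
rewrite /mxtrace (bigD1 o) //= !mxE !eqxx.
rewrite (eq_bigr (fun c => realC (y c c))) => [|c /negPf co]; last first.
  by rewrite !mxE eqxx co.
by rewrite -realC_sum -realCD subrK.
Qed.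

Lemma herm_coordK w (o : 'I_w) (A : 'M[C]_w) : tau1 R w A ->
  herm_of o (herm_coord A) = A.
Proof.
move=> [hA tA]; apply/matrixP => a b; rewrite mxE.
have dg c : A c c = realC (complex.Re (A c c)).
  have := hA c c; rewrite conjcE; case: (A c c) => x y /= [] /eqP.
  by rewrite -addr_eq0 -mulr2n mulrn_eq0 /= => /eqP ->.
case: eqVneq => [<-|ab].
  case: eqP => [->|_]; last by rewrite /herm_coord eqxx -dg.
  under eq_bigr do rewrite /herm_coord eqxx.
  rewrite [RHS]dg; congr realC.
  have -> : 1 = complex.Re (\tr A) by rewrite tA.
  by rewrite /mxtrace Re_sum (bigD1 o) //= addrK.
rewrite /herm_coord (eq_sym b) (negPf ab).
case: ltngtP => [h|h|/val_inj h].
- by case: (A a b).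
- by rewrite (hA b a) conjcE; case: (A b a).
- by rewrite h eqxx in ab.
Qed.

Lemma herm_ofK w (o : 'I_w) y a b : (a, b) != (o, o) ->
  herm_coord (herm_of o y) a b = y a b.
Proof.
rewrite /herm_coord xpair_eqE; case: (eqVneq a b) => [<-|ab].
  by rewrite andbb => /negPf ao; rewrite mxE eqxx ao.
move=> _; rewrite !mxE (eq_sym b) (negPf ab).
case: ltngtP => [h|h|/val_inj h] //.
by rewrite h eqxx in ab.
Qed.

Lemma eq_herm_of w (o : 'I_w) y z :
  (forall a b, (a, b) != (o, o) -> y a b = z a b) -> herm_of o y = herm_of o z.
Proof.
move=> yz; apply/matrixP => a b; rewrite !mxE; case: (eqVneq a b) => [_|ab].
  case: (eqVneq a o) => [_|ao]; last by rewrite yz // xpair_eqE negb_and ao.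
  congr (realC (1 - _)); apply: eq_bigr => c co.
  by rewrite yz // xpair_eqE negb_and co.
by rewrite !yz // xpair_eqE; apply/negP => /andP[/eqP h1 /eqP h2];
  rewrite h1 h2 eqxx in ab.
Qed.

Lemma herm_of_convex w (o : 'I_w) y z (t : R) :
  herm_of o (fun a b => (1 - t) * y a b + t * z a b) =
  realC (1 - t) *: herm_of o y + realC t *: herm_of o z.
Proof.
apply/matrixP => a b; rewrite !mxE; case: eqVneq => _.
  rewrite -!realCM -realCD; case: eqVneq => _ //.
  by rewrite big_split /= -!mulr_sumr; congr realC; ring.
case: ifP => _; apply/eqP; rewrite eq_complex /=; apply/andP; split; apply/eqP; ring.
Qed.

Lemma psd_convex w (A B : 'M[C]_w) (t : R) : 0 <= t <= 1 ->
  psd R A -> psd R B -> psd R (realC (1 - t) *: A + realC t *: B).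
Proof.
move=> /andP[t0 t1] pA pB v.
rewrite (_ : (\sum_i _) =
    realC (1 - t) * (\sum_i \sum_j (v i ord0)^* * A i j * v j ord0) +
    realC t * (\sum_i \sum_j (v i ord0)^* * B i j * v j ord0)).
  by rewrite addr_ge0 // mulr_ge0 // realC_ge0 // subr_ge0.
rewrite !mulr_sumr -big_split; apply: eq_bigr => i _ /=.
rewrite !mulr_sumr -big_split; apply: eq_bigr => j _ /=.
by rewrite !mxE; ring.
Qed.

Lemma herm_of_cpolyfun d w (o : 'I_w) (y : 'rV[R]_d -> 'I_w -> 'I_w -> R) :
  (forall a b, polyfun (fun x => y x a b)) ->
  forall a b, cpolyfun (fun x => herm_of o (y x) a b).
Proof.
move=> yP a b; under eq_fun do rewrite mxE.
case: (a == b).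
  apply: cpolyfun_complex; last exact: polyfun_cst.
  case: (a == o) => //; apply: polyfunD; first exact: polyfun_cst.
  by apply: polyfunN; apply: polyfun_sum.
by case: (a < b)%N; apply: cpolyfun_complex => //; exact: polyfunN.
Qed.

(** For each test vector the form is polynomial in the parameter, and being nonnegative means zero
    imaginary part and nonnegative real part; both are closed conditions. *)
Lemma psd_closed d w (A : 'rV[R]_d -> 'M[C]_w) :
  (forall a b, cpolyfun (fun x => A x a b)) -> closed [set x | psd R (A x)].
Proof.
move=> AP; pose q (v : 'cV[C]_w) x := \sum_i \sum_j (v i ord0)^* * A x i j * v j ord0.
have qP v : cpolyfun (q v).
  apply: cpolyfun_sum => i; apply: cpolyfun_sum => j.
  apply: cpolyfunM; last exact: cpolyfun_cst.
  by apply: cpolyfunM => //; exact: cpolyfun_cst.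
rewrite (_ : [set x | _] = \bigcap_(v in setT) ([set x | complex.Im (q v x) = 0]
    `&` [set x | 0 <= complex.Re (q v x)])).
  apply: closed_bigI => v _; have [/polyfun_continuous qr /polyfun_continuous qi] := qP v.
  apply: closedI.
    by apply: (preimage_closed (f := fun x => complex.Im (q v x)) (D := [set 0])) => [x _|]; [exact: qi|exact: closed_eq].
  by apply: (preimage_closed (f := fun x => complex.Re (q v x)) (D := [set y | 0 <= y])) => [x _|]; [exact: qr|exact: closed_ge].
apply/seteqP; split => x /= H v; have := H v; rewrite -/(q v x) lecE /=.
  by move=> h _; move: h => /andP[/eqP -> ->].
by move=> /(_ I)[-> ->]; rewrite eqxx.
Qed.

End HermitianCoordinates.
Arguments herm_coord {R w}.
Arguments herm_of {R w}.

(** * Polynomial parametrization of mixtures; compactness and connectedness *)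

Section Parametrization.
Set Implicit Arguments.
Variables (R : realType) (p : nat) (n : 'I_p -> nat).
Hypothesis hn : forall j, (0 < n j)%N.
Variable k : nat.
Local Notation C := R[i].

Definition base (j : 'I_p) : 'I_(n j) := Ordinal (hn j).

Definition free_coord (j : 'I_p) : finType :=
  {ab : 'I_(n j) * 'I_(n j) | ab != (base j, base j)}.

(** Mixtures have [k.+1] terms. The weight of term 0 is fixed by the other [k], and in each factor
    the base diagonal coordinate is fixed by the trace. *)
Definition params : finType :=
  ('I_k + 'I_k.+1 * {j : 'I_p & free_coord j})%type.

Definition dimp : nat := #|params|.

Lemma dimpE : dimp = (k + k.+1 * \sum_j (n j ^ 2 - 1))%N.
Proof.
rewrite /dimp card_sum card_prod !card_ord card_tagged sumnE big_map.
rewrite -big_enum /=; congr (_ + _ * _)%N; apply: eq_bigr => j _.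
rewrite card_sig (eq_card (B := predC1 (base j, base j))) //.
by rewrite cardC1 card_prod card_ord mulnn subn1.
Qed.

Definition param (v : 'rV[R]_dimp) (q : params) : R := v ord0 (enum_rank q).

Definition weight (v : 'rV[R]_dimp) (l : 'I_k.+1) : R :=
  if unlift ord0 l is Some i then param v (inl i) else 1 - \sum_i param v (inl i).

Definition factor_coord (v : 'rV[R]_dimp) (l : 'I_k.+1) (j : 'I_p)
    (a b : 'I_(n j)) : R :=
  if insub (a, b) : option (free_coord j) is Some s
  then param v (inr (l, Tagged free_coord s)) else 0.
Arguments factor_coord : clear implicits.

Definition factor (v : 'rV[R]_dimp) (l : 'I_k.+1) (j : 'I_p) : 'M[C]_(n j) :=
  herm_of (base j) (factor_coord v l j).

Definition mixture (v : 'rV[R]_dimp) : 'M[C]_(Ndim n) :=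
  \sum_l realC (weight v l) *: tensor_mx R (factor v l).

(** Total weight, Hermitian symmetry and unit trace are built into the parametrization, so only the
    positivity conditions remain. *)
Definition admissible : set 'rV[R]_dimp :=
  [set v | (forall l, 0 <= weight v l) /\ (forall l j, psd R (factor v l j))].

Lemma sum_weight v : \sum_l weight v l = 1.
Proof.
rewrite big_ord_recl /weight unlift_none.
by under [X in _ + X]eq_bigr do rewrite liftK; rewrite subrK.
Qed.

Lemma factor_density v l j : psd R (factor v l j) -> density R (n j) (factor v l j).
Proof.
by move=> h; split; [exact: herm_of_hermitian|split => //; exact: herm_of_trace].
Qed.

(** Missing terms get weight 0 and repeat the first state. This needs a first state, and [m = 0] is
    excluded because the weights sum to 1. *)
Lemma convex_comb_pad (m : nat) M : (m <= k.+1)%N ->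
  convex_comb_prod R n m M -> convex_comb_prod R n k.+1 M.
Proof.
case: m => [_ [w [P [_ [/esym/eqP]]]]|m mk].
  by rewrite big_ord0 oner_eq0.
move=> [w [P [w0 [w1 [Pp ->]]]]].
pose w' (l : 'I_k.+1) := if insub (l : nat) : option 'I_m.+1 is Some i then w i else 0.
pose P' (l : 'I_k.+1) := if insub (l : nat) : option 'I_m.+1 is Some i then P i else P ord0.
have ext (V : nmodType) (F : 'I_m.+1 -> V) (G : 'I_k.+1 -> V) :
    (forall i : 'I_m.+1, G (widen_ord mk i) = F i) ->
    (forall l : 'I_k.+1, (m.+1 <= l)%N -> G l = 0) -> \sum_l G l = \sum_i F i.
  move=> GF G0; rewrite (bigID (fun l : 'I_k.+1 => (l < m.+1)%N)) /=.
  rewrite [X in _ + X]big1 ?addr0; last by move=> l; rewrite -leqNgt; exact: G0.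
  by rewrite (big_ord_narrow mk); apply: eq_bigr => i _; rewrite GF.
have w'i i : w' (widen_ord mk i) = w i by rewrite /w' valK.
have P'i i : P' (widen_ord mk i) = P i by rewrite /P' valK.
have w'0 (l : 'I_k.+1) : (m.+1 <= l)%N -> w' l = 0.
  by move=> h; rewrite /w' insubF // ltnNge h.
exists w', P'; split; [|split; [|split]].
- by move=> l; rewrite /w'; case: insub.
- by rewrite -w1; apply: ext.
- by move=> l; rewrite /P'; case: insub.
- apply/esym/ext => [i|l /w'0 ->]; first by rewrite w'i P'i.
  exact: scale0r.
Qed.

Lemma Sigma_kE : Sigma_k R n k.+1 = mixture @` admissible.
Proof.
apply/seteqP; split => [M [m [mk /(convex_comb_pad mk)]]|_ [v [w0 fp] <-]]; last first.
  exists k.+1; split => //; exists (weight v), (fun l => tensor_mx R (factor v l)).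
  split => //; split; first exact: sum_weight; split=> // l.
  by exists (factor v l); split=> // j; exact: factor_density.
move=> [w [P [w0 [w1 [/choice[A HA] ->]]]]].
(* The parameters are read off the given mixture: all weights but the first, and the free
   coordinates of every factor. *)
pose v : 'rV[R]_dimp := \row_q match enum_val q : params with
  | inl i => w (lift ord0 i)
  | inr (l, s) => herm_coord (A l (tag s)) (val (tagged s)).1 (val (tagged s)).2
  end.
have vw l : weight v l = w l.
  rewrite /weight /param; case: unliftP => [i|] ->.
    by rewrite mxE enum_rankK.
  under eq_bigr do rewrite mxE enum_rankK.
  by rewrite -w1 big_ord_recl addrK.
have vf l j : factor v l j = A l j.
  have [dA _] := HA l; have [hA [pA tA]] := dA j.
  rewrite -[RHS](herm_coordK (base j)) //; apply: eq_herm_of => a b ab.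
  by rewrite /factor_coord insubT /param mxE enum_rankK.
exists v.
  split=> [l|l j]; first by rewrite vw.
  by rewrite vf; have [/(_ j)[_ []]] := HA l.
apply: eq_bigr => l _; rewrite vw; congr (_ *: _).
have [_ ->] := HA l; congr tensor_mx.
by apply: functional_extensionality_dep => j; rewrite vf.
Qed.

Lemma param_polyfun q : polyfun (fun v => param v q).
Proof. exact: polyfun_coord. Qed.

Lemma weight_polyfun l : polyfun (fun v => weight v l).
Proof.
rewrite /weight; case: (unlift ord0 l) => [i|]; first exact: param_polyfun.
apply: polyfunD; first exact: polyfun_cst.
by apply: polyfunN; apply: polyfun_sum => i; exact: param_polyfun.
Qed.

Lemma factor_cpolyfun l j a b : cpolyfun (fun v => factor v l j a b).
Proof.
apply: herm_of_cpolyfun => {}a {}b; rewrite /factor_coord.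
by case: insub => [s|]; [exact: param_polyfun|exact: polyfun_cst].
Qed.

Lemma mixture_cpolyfun a b : cpolyfun (fun v => mixture v a b).
Proof.
under eq_fun do rewrite /mixture summxE.
apply: cpolyfun_sum => l; under eq_fun do rewrite !mxE.
apply: cpolyfunM; last by apply: cpolyfun_prod => j; exact: factor_cpolyfun.
apply: cpolyfun_complex; [exact: weight_polyfun|exact: polyfun_cst].
Qed.

Lemma mixture_continuous : continuous mixture.
Proof.
apply: mx_continuous => a b; apply: cpolyfun_continuous.
exact: mixture_cpolyfun.
Qed.

(** Each parameter is either a weight, hence in [0, 1], or a coordinate of a density matrix, hence
    in [-1, 1]. *)
Lemma admissible_unit_cube : admissible `<=` unit_cube.
Proof.
move=> v [w0 fp] q; rewrite -ler_norml.
rewrite -[q]enum_valK; case: (enum_val q) => [i|[l [j s]]].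
  have <- : weight v (lift ord0 i) = v ord0 (enum_rank (inl i : params)).
    by rewrite /weight liftK.
  rewrite ger0_norm // -(sum_weight v) (bigD1 (lift ord0 i)) //=.
  by rewrite lerDl sumr_ge0.
have <- : factor_coord v l j (val s).1 (val s).2 =
    v ord0 (enum_rank (inr (l, Tagged free_coord s) : params)).
  by rewrite /factor_coord -surjective_pairing valK.
rewrite -(@herm_ofK _ _ (base j)); last first.
  by rewrite -surjective_pairing; exact: (valP s).
by apply: herm_coord_bound; exact: factor_density.
Qed.

Lemma admissible_closed : closed admissible.
Proof.
rewrite (_ : admissible = (\bigcap_(l in setT) [set v | 0 <= weight v l]) `&`
  \bigcap_(l in setT) \bigcap_(j in setT) [set v | psd R (factor v l j)]).
  apply: closedI; apply: closed_bigI => l _.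
    apply: (preimage_closed (f := fun v => weight v l) (D := [set y | 0 <= y])).
      by move=> v _; exact: polyfun_continuous (weight_polyfun l) v.
    exact: closed_ge.
  apply: closed_bigI => j _; apply: psd_closed => a b; exact: factor_cpolyfun.
apply/seteqP; split => v /= [w0 fp]; split.
- by move=> l _; exact: w0.
- by move=> l _ j _; exact: fp.
- by move=> l; exact: w0.
- by move=> l j; exact: (fp l I j I).
Qed.

Lemma unit_cube_compact d : compact (@unit_cube R d).
Proof.
rewrite (_ : unit_cube = [set v : 'rV[R]_d | forall i, `[-1, 1]%classic (v ord0 i)]).
  apply: (@rV_compact R d (fun=> `[-1, 1]%classic)) => i.
  exact: segment_compact.
by apply/seteqP; split => x Hx i; have := Hx i; rewrite /= in_itv.
Qed.

Lemma Sigma_k_compact : compact (Sigma_k R n k.+1).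
Proof.
rewrite Sigma_kE; apply: continuous_compact.
  by apply: continuous_subspaceT; exact: mixture_continuous.
exact: subclosed_compact admissible_closed (@unit_cube_compact _) admissible_unit_cube.
Qed.

Lemma admissible_convex u v (t : R) : 0 <= t <= 1 ->
  admissible u -> admissible v -> admissible ((1 - t) *: u + t *: v).
Proof.
move=> t01 [u0 uf] [v0 vf].
have pE q : param ((1 - t) *: u + t *: v) q = (1 - t) * param u q + t * param v q.
  by rewrite /param !mxE.
have wE l : weight ((1 - t) *: u + t *: v) l = (1 - t) * weight u l + t * weight v l.
  rewrite /weight; case: unlift => [i|]; first exact: pE.
  by under eq_bigr do rewrite pE; rewrite big_split /= -!mulr_sumr; ring.
have fE l j : factor ((1 - t) *: u + t *: v) l j =
    realC (1 - t) *: factor u l j + realC t *: factor v l j.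
  rewrite -herm_of_convex; apply: eq_herm_of => a b _; rewrite /factor_coord.
  by case: insub => [s|]; rewrite ?pE // !mulr0 addr0.
split=> [l|l j]; last by rewrite fE; exact: psd_convex.
by case/andP: t01 => *; rewrite wE addr_ge0 // mulr_ge0 // subr_ge0.
Qed.

(** The admissible set is convex, hence a union of segments issuing from one of its points, and the
    mixture map is continuous. *)
Lemma Sigma_k_connected : connected (Sigma_k R n k.+1).
Proof.
rewrite Sigma_kE; apply: connected_continuous_connected; last first.
  by apply: continuous_subspaceT; exact: mixture_continuous.
have [->|/set0P[u au]] := eqVneq admissible set0; first exact: connected0.
pose seg v (t : R) := (1 - t) *: u + t *: v.
rewrite (_ : admissible = \bigcup_(v in admissible) (seg v @` `[0, 1]%classic)).
  apply: bigcup_connected.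
    by exists u => v _; exists 0; rewrite /seg /= ?in_itv /= ?lexx ?ler01 // subr0 scale1r scale0r addr0.
  move=> v _; apply: connected_continuous_connected; first exact: segment_connected.
  apply: continuous_subspaceT => t; apply: cvgD; apply: cvgZr_tmp.
    by apply: cvgB; [exact: cvg_cst|exact: cvg_id].
  exact: cvg_id.
apply/seteqP; split=> [v av|_ [v av [t t01 <-]]].
  by exists v => //; exists 1; rewrite /seg /= ?in_itv /= ?lexx ?ler01 // subrr scale1r scale0r add0r.
by apply: admissible_convex => //; move: t01; rewrite /= in_itv.
Qed.

End Parametrization.

(** * Null sets read in affine charts of the hyperplane *)

Section ChartNull.
Set Implicit Arguments.
Variable R : realType.
Local Notation C := R[i].

(** Turns complex matrices into real row vectors, so that rank arguments over the reals apply to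
    charts. *)
Definition realvec (w : nat) (M : 'M[C]_w) : 'rV[R]_(w * w + w * w) :=
  row_mx (mxvec (map_mx (@complex.Re R) M)) (mxvec (map_mx (@complex.Im R) M)).

Lemma realvecD w (A B : 'M[C]_w) : realvec (A + B) = realvec A + realvec B.
Proof.
rewrite /realvec add_row_mx -!linearD /=; congr (row_mx (mxvec _) (mxvec _));
  by apply/matrixP => i j; rewrite !mxE ?ReD ?ImD.
Qed.

Lemma realvec0 w : realvec (0 : 'M[C]_w) = 0.
Proof. by apply: (addrI (realvec 0)); rewrite -realvecD !addr0. Qed.

Lemma realvecZ w (t : R) (A : 'M[C]_w) : realvec (realC t *: A) = t *: realvec A.
Proof.
rewrite /realvec scale_row_mx -!linearZ /=; congr (row_mx (mxvec _) (mxvec _));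
  apply/matrixP => i j; rewrite !mxE; case: (A i j) => x y /=; ring.
Qed.

Lemma realvec_sum w (I : finType) (t : I -> R) (E : I -> 'M[C]_w) :
  realvec (\sum_i realC (t i) *: E i) = \sum_i t i *: realvec (E i).
Proof.
rewrite (big_morph (@realvec w) (@realvecD w) (realvec0 w)).
by apply: eq_bigr => i _; rewrite realvecZ.
Qed.

Lemma realvec_inj w : injective (@realvec w).
Proof.
move=> A B /eq_row_mx[/(can_inj mxvecK)/matrixP rAB /(can_inj mxvecK)/matrixP iAB].
apply/matrixP => a b; have := rAB a b; have := iAB a b; rewrite !mxE.
by case: (A a b); case: (B a b) => x y u v /= -> ->.
Qed.

Lemma realvec_polyfun d w (F : 'rV[R]_d -> 'M[C]_w) :
  (forall a b, cpolyfun (fun v => F v a b)) ->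
  forall q, polyfun (fun v => realvec (F v) ord0 q).
Proof.
move=> FP q; rewrite /realvec; under eq_fun do rewrite mxE.
case: (fintype.split q) => {}q; case/mxvec_indexP: q => a b;
  by under eq_fun do rewrite mxvecE mxE; have [] := FP a b.
Qed.

(** Injectivity of the chart makes the directions [E i] linearly independent over the reals, so a
    right inverse of their matrix recovers the coordinates. *)
Lemma tau1_chart_linear w (phi : 'rV[R]_(w * w - 1) -> 'M[C]_w) : tau1_chart R phi ->
  exists M0 (E : 'I_(w * w - 1) -> 'M[C]_w),
    (forall x, phi x = M0 + \sum_i realC (x ord0 i) *: E i) /\
    exists P : 'M[R]_(w * w + w * w, w * w - 1),
      forall x, x = (realvec (phi x) - realvec M0) *m P.
Proof.
move=> [[M0 [E phiE]] [inj _]]; exists M0, E; split => //.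
pose B := \matrix_i realvec (E i).
have vE x : realvec (phi x) = realvec M0 + x *m B.
  rewrite phiE realvecD realvec_sum mulmx_sum_row.
  by congr (_ + _); apply: eq_bigr => i _; rewrite rowK.
have Bfree : row_free B.
  rewrite -kermx_eq0; apply/rowV0P => u /sub_kermxP uB.
  by apply: inj; apply: realvec_inj; rewrite !vE uB mul0mx.
by exists (pinvmx B) => x; rewrite vE addrC addKr mulmxKp.
Qed.

Lemma polynomial_image_tau1_null d w (F : 'rV[R]_d -> 'M[C]_w) :
  (d < w * w - 1)%N -> (forall a b, cpolyfun (fun v => F v a b)) ->
  tau1_null R (F @` unit_cube).
Proof.
move=> dw FP phi /tau1_chart_linear[M0 [E [_ [P PE]]]].
(* [g v] is defined for every v and gives the chart coordinates of [F v] whenever [F v] is in the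
   range of [phi]. *)
pose g v := (realvec (F v) - realvec M0) *m P.
apply: (@lebesgue_null_subset _ _ _ (g @` unit_cube)).
  by move=> x [v v1 Fv]; exists v => //; rewrite [RHS]PE /g Fv.
have gP j : polyfun (fun v => g v ord0 j).
  under eq_fun do rewrite mxE; apply: polyfun_sum => q.
  under eq_fun do rewrite mxE; apply: polyfunM; last exact: polyfun_cst.
  apply: polyfunD; first exact: realvec_polyfun.
  exact: polyfun_cst.
have /choice[L HL] : forall j, exists L : R, 0 <= L /\
    forall x y (h : R), 0 <= h -> unit_cube x -> unit_cube y ->
    (forall i, `|x ord0 i - y ord0 i| <= h) -> `|g x ord0 j - g y ord0 j| <= L * h.
  by move=> j; have [L L0 [_ HL]] := polyfun_lipschitz (gP j); exists L.
(* The sum of the coordinatewise constants serves for all coordinates at once. *)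
apply: (@lipschitz_image_null _ _ _ _ (\sum_j L j)) => //.
move=> x y h h0 x1 y1 xy j; have [_ /(_ x y h h0 x1 y1 xy)] := HL j.
move=> /le_trans; apply; rewrite ler_wpM2r // (bigD1 j) //= lerDl.
by apply: sumr_ge0 => i _; have [] := HL i.
Qed.

Lemma tau1_null_subset w (A B : set 'M[C]_w) :
  A `<=` B -> tau1_null R B -> tau1_null R A.
Proof.
move=> AB nB phi /nB; apply: lebesgue_null_subset => x; exact: AB.
Qed.

End ChartNull.

(** * Comparison of dimensions for (b) *)

Section Dimension.
Set Implicit Arguments.

Lemma NdimE (p : nat) (n : 'I_p -> nat) : Ndim n = (\prod_j n j)%N.
Proof.
rewrite /Ndim /tidx card_dep_ffun foldrE big_image /=.
by apply: eq_bigr => j _; rewrite card_ord.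
Qed.

(** With S the sum of the n_j^2 - 1, the denominator is S + 1 and the number of parameters is
    (k+1)(S+1) - 1, while the hypothesis says (k+1)(S+1) < N^2. *)
Lemma dimension_count (R : realType) (p : nat) (n : 'I_p -> nat) (k : nat) :
  (forall j, (0 < n j)%N) ->
  ((k.+1)%:R : R) < (\prod_(j : 'I_p) (n j ^ 2)%N)%:R
                 / (1 - p%:R + \sum_(j : 'I_p) (n j ^ 2)%N%:R) ->
  (k + k.+1 * \sum_j (n j ^ 2 - 1) < Ndim n * Ndim n - 1)%N.
Proof.
move=> hn; set S := (\sum_j (n j ^ 2 - 1))%N.
have -> : 1 - p%:R + \sum_(j : 'I_p) (n j ^ 2)%N%:R = (S.+1)%:R :> R.
  have -> : p%:R = \sum_(j < p) 1 :> R by rewrite sumr_const card_ord.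
  rewrite addrAC -addrA -sumrB -natr1 addrC natr_sum; congr (_ + _).
  by apply: eq_bigr => j _; rewrite natrB // expn_gt0 hn.
rewrite ltr_pdivlMr ?ltr0n // -natrM ltr_nat => h.
rewrite ltn_subRL; apply: leq_trans (_ : k.+1 * S.+1 < _)%N.
  by rewrite mulnS !addSn add0n.
by rewrite NdimE -big_split /= (eq_bigr (fun j => n j ^ 2)%N) // => j _; rewrite mulnn.
Qed.

End Dimension.

(** * Products of sums over dependent index types *)

Section DependentDistributivity.
Set Implicit Arguments.
Variables (V : comNzSemiRingType) (I : finType) (T : I -> finType).

Lemma prod_sum_dffun (F : forall i, T i -> V) :
  \prod_i \sum_t F i t = \sum_(f : {dffun forall i, T i}) \prod_i F i (f i).
Proof.
rewrite (reindex (@dffun_of_fprod I T)); last first.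
  by apply: onW_bij; exact: dffun_of_fprod_bij.
transitivity (\sum_(t : fprod T) \prod_(i in I) (finfun (F i)) (t i)).
  transitivity (\prod_i \sum_(j in tagged_with T i) untag 0 (finfun (F i)) j).
    apply: eq_bigr => i _; transitivity (\sum_t finfun (F i) t).
      by apply: eq_bigr => t _; rewrite ffunE.
    exact: (big_tag (fun i => finfun (F i) : T i -> V) i).
  by rewrite bigA_distr_big_dep; apply/esym; exact: big_fprod.
by apply: eq_bigr => t _; apply: eq_bigr => i _; rewrite !ffunE.
Qed.

(** Full distributivity is applied after replacing the factor at [i0] by the indicator of [t0 i0]:
    its sum is 1, and it removes every [f] with another value at [i0]. *)
Lemma prod_sum_dffun_fix (i0 : I) (t0 : forall i, T i) (F : forall i, T i -> V) :
  \prod_(i | i != i0) \sum_t F i t =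
  \sum_(f : {dffun forall i, T i} | f i0 == t0 i0) \prod_(i | i != i0) F i (f i).
Proof.
pose F' i (t : T i) : V := if i == i0 then (t == t0 i)%:R else F i t.
have := prod_sum_dffun F'; rewrite (bigD1 i0) //= {1}/F' eqxx.
rewrite (bigD1 (t0 i0)) //= eqxx big1 ?addr0 ?mul1r; last by move=> t /negPf ->.
rewrite (eq_bigr (fun i => \sum_t F i t)); last first.
  by move=> i /negPf ii0; apply: eq_bigr => t _; rewrite /F' ii0.
move=> ->; rewrite [RHS]big_mkcond; apply: eq_bigr => f _.
rewrite (bigD1 i0) //= {1}/F' eqxx; case: eqP => _; rewrite ?mul0r // mul1r.
by apply: eq_bigr => i /negPf ii0; rewrite /F' ii0.
Qed.

End DependentDistributivity.

(** * Pure states spanning the full matrix algebra *)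

Section SpanningDensities.
Set Implicit Arguments.
Variable R : realType.
Local Notation C := R[i].

(** The quadratic form at v is s times the squared modulus of the inner product of v and u. *)
Lemma rank_one_density w (s : R) (u : 'I_w -> C) : 0 <= s ->
  realC s * (\sum_i u i * (u i)^*) = 1 ->
  density R w (\matrix_(i, j) (realC s * (u i * (u j)^*))).
Proof.
move=> s0 us; have cs : (realC s : C)^* = realC s by rewrite conjcE /= oppr0.
split; last split.
- by move=> i j; rewrite !mxE !rmorphM /= conjCK cs (mulrC (u j)).
- move=> v; pose z := \sum_i (v i ord0)^* * u i.
  rewrite (_ : (\sum_i _) = realC s * (z * z^*)).
    by rewrite mulr_ge0 ?realC_ge0 // mul_conjC_ge0.
  rewrite {2}/z rmorph_sum /= mulr_sumr mulr_sumr exchange_big /=.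
  apply: eq_bigr => j _; rewrite rmorphM /= conjCK /z mulr_suml mulr_sumr.
  by apply: eq_bigr => i _; rewrite mxE; ring.
- by rewrite -us mulr_sumr; apply: eq_bigr => i _; rewrite mxE.
Qed.

(** The order of a and b selects between the two states of an unordered pair: phase 1 if a < b,
    phase i if a > b. *)
Definition span_phase w (a b : 'I_w) : C :=
  if a == b then 0 else if (a < b)%N then 1 else Complex 0 1.

(* The pure states e_a, (e_a + e_b)/sqrt 2 and (e_a + i e_b)/sqrt 2. *)
Definition span_dm w (ab : 'I_w * 'I_w) : 'M[C]_w :=
  let u i := (i == ab.1)%:R + span_phase ab.1 ab.2 * (i == ab.2)%:R in
  \matrix_(i, j) (realC (if ab.1 == ab.2 then 1 else 2^-1) * (u i * (u j)^*)).

Lemma span_dm_density w (ab : 'I_w * 'I_w) : density R w (span_dm ab).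
Proof.
case: ab => a b; apply: rank_one_density => /=; first by case: ifP.
rewrite (eq_bigr (fun i => ((i == a)%:R + span_phase a b * (i == b)%:R)^* *
   ((i == a)%:R + span_phase a b * (i == b)%:R))); last by move=> i _; rewrite mulrC.
rewrite sum_two !rmorphD !rmorphM /= !conjC_nat !eqxx /span_phase (eq_sym b).
case: eqVneq => [_|ab] /=.
  by apply/eqP; rewrite eq_complex /= ?conjcE /=; apply/andP; split; apply/eqP; ring.
case: ifP => _; apply/eqP; rewrite eq_complex /= ?conjcE /=; apply/andP; split; apply/eqP; field; done.
Qed.

Lemma span_dmE w (a b : 'I_w) : span_dm (a, b) =
  realC (if a == b then 1 else 2^-1) *: (delta_mx a a + (span_phase a b)^* *: delta_mx a b
    + span_phase a b *: delta_mx b a + (span_phase a b * (span_phase a b)^*) *: delta_mx b b).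
Proof.
apply/matrixP => i j; rewrite !mxE rmorphD rmorphM /= !conjC_nat; congr (_ * _).
have E (x y : bool) : (x && y)%:R = x%:R * y%:R :> C.
  by case: x; case: y; rewrite ?mulr1 ?mulr0.
by rewrite !E; ring.
Qed.

Lemma span_dm_span w (X : 'M[C]_w) : exists c, X = \sum_ab c ab *: span_dm ab.
Proof.
pose Sp X := exists c, X = \sum_ab c ab *: span_dm (w := w) ab.
have SpD X1 X2 : Sp X1 -> Sp X2 -> Sp (X1 + X2).
  move=> [c1 ->] [c2 ->]; exists (fun t => c1 t + c2 t).
  by rewrite -big_split; apply: eq_bigr => t _; rewrite scalerDl.
have SpZ u X1 : Sp X1 -> Sp (u *: X1).
  move=> [c1 ->]; exists (fun t => u * c1 t).
  by rewrite scaler_sumr; apply: eq_bigr => t _; rewrite scalerA.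
have SpB t : Sp (span_dm t).
  exists (fun t' => (t' == t)%:R); rewrite (bigD1 t) //= eqxx scale1r.
  by rewrite big1 ?addr0 // => t' /negPf ->; rewrite scale0r.
have SpE a : Sp (delta_mx a a).
  have -> : delta_mx a a = span_dm (a, a); last exact: SpB.
  rewrite span_dmE /span_phase eqxx rmorph0 mul0r !scale0r !addr0.
  by rewrite (_ : realC 1 = 1) ?scale1r.
have SpElt (a b : 'I_w) : (a < b)%N -> Sp (delta_mx a b) /\ Sp (delta_mx b a).
  move=> ab; have [ba abF] : (b < a)%N = false /\ (a == b) = false.
    by split; [exact: ltn_geF (ltnW _)|exact: ltn_eqF].
  (* [D] cancels the diagonal of both states. Then [P] is (E_ab + E_ba)/2 and [Q] is (E_ba -
     E_ab)/2, so the matrix units are [P - Q] and [P + Q]. *)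
  pose D : 'M[C]_w := realC (- 2^-1) *: (delta_mx a a + delta_mx b b).
  pose P := span_dm (a, b) + D; pose Q := Complex 0 1 *: (span_dm (b, a) + D).
  have SpP : Sp P by apply: (SpD _ _) => //; apply: (SpZ _ _); apply: (SpD _ _).
  have SpQ : Sp Q by apply: (SpZ _ _); apply: (SpD _ _) => //; apply: (SpZ _ _); apply: (SpD _ _).
  have Eab : delta_mx a b = P + (-1) *: Q.
    rewrite /P /Q /D !span_dmE /span_phase (eq_sym b) abF ab ba !conjcE.
    apply/matrixP => i j; rewrite !mxE.
    move: ((i == a) && (j == a))%:R ((i == a) && (j == b))%:R
      ((i == b) && (j == a))%:R ((i == b) && (j == b))%:R.
    move=> [? ?] [? ?] [? ?] [? ?]; apply/eqP; rewrite eq_complex /=.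
    by apply/andP; split; apply/eqP; field.
  have Eba : delta_mx b a = P + Q.
    rewrite /P /Q /D !span_dmE /span_phase (eq_sym b) abF ab ba !conjcE.
    apply/matrixP => i j; rewrite !mxE.
    move: ((i == a) && (j == a))%:R ((i == a) && (j == b))%:R
      ((i == b) && (j == a))%:R ((i == b) && (j == b))%:R.
    move=> [? ?] [? ?] [? ?] [? ?]; apply/eqP; rewrite eq_complex /=.
    by apply/andP; split; apply/eqP; field.
  by split; [rewrite Eab; apply: (SpD _ _) => //; exact: SpZ|rewrite Eba; exact: SpD].
have Sp0 : Sp 0 by exists (fun=> 0); rewrite big1 // => t _; exact: scale0r.
rewrite (matrix_sum_delta X).
elim/big_ind: _ => // a _; elim/big_ind: _ => // b _; apply: (SpZ _ _).
case: (ltngtP a b) => [/SpElt[]|/SpElt[]|/val_inj ->] //.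
Qed.

End SpanningDensities.
Arguments span_dm {R w}.

(** * Small Hermitian perturbations of a multiple of the identity *)

Section PsdPerturbation.
Set Implicit Arguments.
Variable R : realType.
Local Notation C := R[i].

(** The form of [H] at v is at most eps w |v|^2 in modulus, by |v_i||v_j| <= (|v_i|^2 +
    |v_j|^2)/2. *)
Lemma psd_perturbation w (kappa eps : R) (H : 'M[C]_w) :
  Defs.hermitian R H -> (forall i j, `|H i j| <= realC eps) ->
  w%:R * eps <= kappa -> psd R (realC kappa *: 1%:M + H).
Proof.
move=> hH bH we v; set nv := \sum_i `|v i ord0| ^+ 2.
pose q := \sum_i \sum_j (v i ord0)^* * H i j * v j ord0.
have nv0 : 0 <= nv by apply: sumr_ge0 => i _; rewrite exprn_ge0.
rewrite (_ : (\sum_i _) = realC kappa * nv + q); last first.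
  rewrite mulr_sumr -big_split; apply: eq_bigr => i _ /=.
  rewrite (eq_bigr (fun j => (if j == i then realC kappa * `|v i ord0| ^+ 2 else 0)
     + (v i ord0)^* * H i j * v j ord0)).
    by rewrite big_split /= -big_mkcond big_pred1_eq.
  move=> j _; rewrite !mxE mulrDr mulrDl; congr (_ + _).
  rewrite eq_sym; case: eqP => [->|_]; last by rewrite mulr0n !mulr0 mul0r.
  by rewrite mulr1n normCK; ring.
(* Complex numbers are only partially ordered, so realness is required before concluding q >=
   -|q|. *)
have qreal : q \is Num.real.
  apply/CrealP; rewrite /q rmorph_sum exchange_big /=; apply: eq_bigr => i _.
  rewrite rmorph_sum; apply: eq_bigr => j _ /=.
  by rewrite !rmorphM /= conjCK -hH; ring.
have qle : `|q| <= realC eps * (w%:R * nv).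
  apply: (@le_trans _ _ (\sum_i \sum_j realC eps * (2^-1 * (`|v i ord0| ^+ 2 + `|v j ord0| ^+ 2)))).
    apply: le_trans (ler_norm_sum _ _ _) _; apply: ler_sum => i _.
    apply: le_trans (ler_norm_sum _ _ _) _; apply: ler_sum => j _.
    rewrite !normrM norm_conjC mulrAC mulrC ler_pM ?mulr_ge0 //.
    have := real_exprn_even_ge0 (n := 2)
       (realB (normr_real (v i ord0)) (normr_real (v j ord0))) isT.
    set x := `|v i ord0|; set y := `|v j ord0|; rewrite sqrrB => h.
    rewrite -subr_ge0.
    have -> : 2^-1 * (x ^+ 2 + y ^+ 2) - x * y = 2^-1 * (x ^+ 2 - x * y *+ 2 + y ^+ 2).
      by field.
    by rewrite mulr_ge0 // invr_ge0.
  under eq_bigr do rewrite -mulr_sumr -mulr_sumr big_split /= sumr_const card_ord.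
  rewrite -mulr_sumr -mulr_sumr big_split /= sumr_const card_ord sumrMnl -/nv.
  by rewrite le_eqVlt; apply/orP; left; apply/eqP; rewrite -mulr_natl; field.
have : 0 <= realC kappa * nv - `|q|.
  rewrite subr_ge0 (le_trans qle) // mulrA ler_wpM2r //.
  rewrite -subr_ge0 (_ : _ - _ = realC (kappa - w%:R * eps)) ?realC_ge0 ?subr_ge0 //.
  rewrite realCB realCM mulrC; congr (_ - _ * _).
  by rewrite -(rmorph_nat (real_complex R)).
move=> h; apply: le_trans h _; rewrite lerD2l.
by have := real_lerNnormlW qreal (lexx _).
Qed.

End PsdPerturbation.

(** * Decomposition along product states in all factors but one *)

Section OpenSubset.
Set Implicit Arguments.
Variables (R : realType) (p : nat) (n : 'I_p -> nat) (j0 : 'I_p).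
Hypothesis hn : forall j, (0 < n j)%N.
Local Notation C := R[i].
Local Notation N := (Ndim n).

Definition multi (a : 'I_N) : tidx n := @enum_val (tidx n) predT a.

Lemma multi_bij : bijective multi.
Proof. exact: enum_val_bij. Qed.

Definition pair_idx (j : 'I_p) : finType := ('I_(n j) * 'I_(n j))%type.

Definition choices : finType := {dffun forall j, pair_idx j}.

Definition base_pair (j : 'I_p) : pair_idx j := (Ordinal (hn j), Ordinal (hn j)).

(* The slot [j0] of a choice is unused, hence pinned. *)
Definition pinned : pred choices := [pred f : choices | f j0 == base_pair j0].

Lemma card_pinned : #|pinned| = (\prod_(j | j != j0) n j ^ 2)%N.
Proof.
have := @prod_sum_dffun_fix nat _ pair_idx j0 base_pair (fun _ _ => 1%N).
rewrite -sum1_card => H.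
transitivity (\prod_(j | j != j0) \sum_(t : pair_idx j) (1 : nat))%R.
  by rewrite H; apply: eq_bigr => f _; rewrite big1.
apply: eq_bigr => j _.
by rewrite sumr_const card_prod card_ord mulnn; exact: natn.
Qed.

(** The product B_f (x) D. Taking [D] as a family over all factors avoids a cast along [j = j0]. *)
Definition tens (f : choices) (D : forall j, 'M[C]_(n j)) : 'M[C]_N :=
  tensor_mx R (fun j => if j == j0 then D j else span_dm (f j)).

Lemma tensE f D a b : tens f D a b = D j0 (multi a j0) (multi b j0) *
  \prod_(j | j != j0) span_dm (f j) (multi a j) (multi b j).
Proof.
rewrite mxE (bigD1 j0) //= eqxx; congr (_ * _).
by apply: eq_bigr => j /negPf ->.
Qed.

Lemma tensor_mx_trace (A : forall j, 'M[C]_(n j)) : \tr (tensor_mx R A) = \prod_j \tr (A j).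
Proof.
rewrite /mxtrace (@prod_sum_dffun C _ (fun j => 'I_(n j)) (fun j t => A j t t)).
rewrite (reindex multi); last exact/onW_bij/multi_bij.
by apply: eq_bigr => a _; rewrite mxE.
Qed.

Lemma tens_trace f D : \tr (tens f D) = \tr (D j0).
Proof.
rewrite tensor_mx_trace (bigD1 j0) //= eqxx big1 ?mulr1 // => j /negPf ->.
by have [_ []] := span_dm_density R (f j).
Qed.

Section Slices.
Variable c : forall j, pair_idx j -> pair_idx j -> C.
Hypothesis cE : forall j (t : pair_idx j),
  delta_mx t.1 t.2 = \sum_s c t s *: span_dm (R := R) s.

Definition coef (f : choices) (a b : 'I_N) : C :=
  \prod_(j | j != j0) c ((multi a j, multi b j) : pair_idx j) (f j).

(** At [j0] this is S_f(X): X is expanded in matrix units, these are expanded in spanning states in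
    all factors but [j0], and the coefficient of B_f is collected. *)
Definition slice (X : 'M[C]_N) (f : choices) (j : 'I_p) : 'M[C]_(n j) :=
  \matrix_(i, i') \sum_a \sum_b X a b * coef f a b *
     ((i == multi a j) && (i' == multi b j))%:R.

(** Both sides are linear in X, so after exchanging sums the claim is that each tensor product of
    matrix units is recovered from its expansion in all factors but [j0]. *)
Lemma slice_sum X : X = \sum_(f in pinned) tens f (slice X f).
Proof.
apply/matrixP => x y; rewrite summxE.
transitivity (\sum_a \sum_b X a b * ((x == a) && (y == b))%:R).
  rewrite (bigD1 x) //= [X in _ + X]big1 ?addr0; last first.
    move=> a; rewrite eq_sym => /negPf ax; rewrite big1 // => b _.
    by rewrite ax mulr0.
  rewrite (bigD1 y) //= !eqxx mulr1 big1 ?addr0 // => b.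
  by rewrite eq_sym => /negPf ->; rewrite andbF mulr0.
under [RHS]eq_bigr do rewrite tensE mxE mulr_suml.
rewrite [RHS]exchange_big; apply: eq_bigr => a _.
under [RHS]eq_bigr do rewrite mulr_suml.
rewrite [RHS]exchange_big; apply: eq_bigr => b _ /=.
under [RHS]eq_bigr do rewrite -!mulrA.
rewrite -mulr_sumr; congr (_ * _).
under [RHS]eq_bigr do rewrite mulrCA -big_split /=.
rewrite -mulr_sumr.
(* Read backwards, distributivity turns the sum over pinned choices into a product of sums, each an
   entry of a matrix unit by [cE]. *)
rewrite -(@prod_sum_dffun_fix C _ pair_idx j0 base_pair (fun j t =>
  c ((multi a j, multi b j) : pair_idx j) t * span_dm t (multi x j) (multi y j))).
rewrite (eq_bigr (fun j => ((multi x j == multi a j) && (multi y j == multi b j))%:R)); last first.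
  move=> j _; have /matrixP/(_ (multi x j) (multi y j)) := cE ((multi a j, multi b j) : pair_idx j).
  rewrite mxE /= => ->; rewrite summxE; by apply: eq_bigr => t _; rewrite [RHS]mxE.
rewrite -(bigD1 (P := predT) j0 (F := fun j => ((multi x j == multi a j) && (multi y j == multi b j))%:R)) //=.
rewrite -natr_prod; congr (_%:R).
have [/andP[/eqP -> /eqP ->]|] := boolP ((x == a) && (y == b)).
  by rewrite big1 // => j _; rewrite !eqxx.
move=> xyab; suff [j /negPf jj] : exists j, ~~ ((multi x j == multi a j) && (multi y j == multi b j)).
  by rewrite (bigD1 j) //= jj mul0n.
(* Indices agreeing in every factor are equal, so a mismatch shows up in some factor and kills the
   product. *)
apply/existsP; rewrite -negb_forall; apply: contra xyab => /forallP H.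
have minj := bij_inj multi_bij.
by apply/andP; split; apply/eqP/minj/ffunP => j; have /andP[/eqP ? /eqP ?] := H j.
Qed.

End Slices.

Lemma tensD f D1 D2 : tens f (fun j => D1 j + D2 j) = tens f D1 + tens f D2.
Proof. by apply/matrixP => a b; rewrite [RHS]mxE !tensE mxE mulrDl. Qed.

Lemma tensZ f u D : tens f (fun j => u *: D j) = u *: tens f D.
Proof. by apply/matrixP => a b; rewrite [RHS]mxE !tensE mxE mulrA. Qed.

Definition adj w (A : 'M[C]_w) : 'M[C]_w := \matrix_(i, j) (A j i)^*.

Lemma span_dm_adj w (t : 'I_w * 'I_w) i j : (span_dm (R := R) t j i)^* = span_dm t i j.
Proof. by have [/(_ j i) ->] := span_dm_density R t. Qed.

Lemma tens_adj f D : tens f (fun j => adj (D j)) = adj (tens f D).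
Proof.
apply/matrixP => a b; rewrite [RHS]mxE !tensE mxE rmorphM rmorph_prod; congr (_ * _).
by apply: eq_bigr => j _; rewrite /= span_dm_adj.
Qed.

(** The traces [t f] become the weights, and dividing [G f] by its trace makes the last factor a
    density matrix. *)
Lemma tensor_convex_comb (k : nat) (G : choices -> forall j, 'M[C]_(n j))
    (t : choices -> R) : (#|pinned| <= k)%N ->
  (forall f, f \in pinned -> [/\ Defs.hermitian R (G f j0), psd R (G f j0),
     \tr (G f j0) = realC (t f) & 0 < t f]) ->
  \sum_(f in pinned) t f = 1 ->
  Sigma_k R n k (\sum_(f in pinned) tens f (G f)).
Proof.
move=> mk HG t1; exists #|pinned|; split => //.
exists (fun l => t (enum_val l)).
exists (fun l => tens (enum_val l) (fun j => realC (t (enum_val l))^-1 *: G (enum_val l) j)).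
split; [|split; [|split]].
- by move=> l; have [_ _ _ /ltW] := HG _ (enum_valP l).
- by rewrite -t1 [RHS]big_enum_val.
- move=> l; set f := enum_val l; have [hG pG tG t0] := HG _ (enum_valP l).
  exists (fun j => if j == j0 then realC (t f)^-1 *: G f j else span_dm (f j)).
  split=> // j; case: eqVneq => [->|_]; last exact: span_dm_density.
  have ti0 : 0 <= realC (t f)^-1 :> C by rewrite realC_ge0 invr_ge0 ltW.
  split; last split.
  + by move=> a b; rewrite !mxE rmorphM /= -hG (geC0_conj ti0).
  + move=> v; rewrite (_ : (\sum_i _) = realC (t f)^-1 *
      \sum_i \sum_j (v i ord0)^* * G f j0 i j * v j ord0); first by rewrite mulr_ge0.
    rewrite mulr_sumr; apply: eq_bigr => a _; rewrite mulr_sumr; apply: eq_bigr => b _.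
    by rewrite mxE; ring.
  + by rewrite mxtraceZ tG -realCM mulVf ?gt_eqF.
- rewrite [RHS](_ : _ = \sum_(l < #|pinned|) tens (enum_val l) (G (enum_val l))).
    by rewrite [LHS]big_enum_val.
  apply: eq_bigr => l _; have [_ _ _ t0] := HG _ (enum_valP l).
  by rewrite tensZ scalerA -realCM mulfV ?gt_eqF // scale1r.
Qed.

End OpenSubset.
Arguments multi {p n}.
Arguments pair_idx {p} n.
Arguments choices {p} n.
Arguments pinned {p n}.
Arguments tens {R p n}.
Arguments coef {R p n}.
Arguments slice {R p n}.
Arguments adj {R w}.

(** * An interior point of the set of mixtures, and positive measure *)

Section InteriorPoint.
Set Implicit Arguments.
Variable R : realType.
Local Notation C := R[i].

Lemma realC_Re (z : C) : 0 <= z -> z = realC (complex.Re z).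
Proof. by case: z => x y /ger0_Im /= ->. Qed.

Lemma psd_trace_ge0 w (A : 'M[C]_w) : psd R A -> 0 <= \tr A.
Proof.
move=> pA; apply: sumr_ge0 => i _.
by have := psd_two i i 0 pA; rewrite rmorph0 !mulr0 !addr0.
Qed.

Lemma adjP w (A : 'M[C]_w) : Defs.hermitian R A <-> adj A = A.
Proof.
split=> [hA|/matrixP hA a b]; first by apply/matrixP => a b; rewrite mxE -hA.
by rewrite -[in LHS]hA mxE.
Qed.

Lemma adjD w (A B : 'M[C]_w) : adj (A + B) = adj A + adj B.
Proof. by apply/matrixP => i j; rewrite !mxE rmorphD. Qed.

Lemma adj_sum w (I : finType) (P : pred I) (A : I -> 'M[C]_w) :
  adj (\sum_(i | P i) A i) = \sum_(i | P i) adj (A i).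
Proof.
have adj0 : adj (0 : 'M[C]_w) = 0 by apply: (addrI (adj 0)); rewrite -adjD !addr0.
exact: (big_morph (@adj R w) (@adjD w) adj0).
Qed.

Lemma adjK w (A : 'M[C]_w) : adj (adj A) = A.
Proof. by apply/matrixP => i j; rewrite !mxE conjCK. Qed.

Lemma adjZ w (s : R) (A : 'M[C]_w) : adj (realC s *: A) = realC s *: adj A.
Proof.
apply/matrixP => i j; rewrite !mxE rmorphM; congr (_ * _).
by rewrite /= conjcE /= oppr0.
Qed.

Lemma adj1 w : adj (1%:M : 'M[C]_w) = 1%:M.
Proof. by apply/matrixP => i j; rewrite !mxE rmorph_nat eq_sym. Qed.

Lemma hermitian_part w (A : 'M[C]_w) :
  Defs.hermitian R (realC 2^-1 *: (A + adj A)).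
Proof. by apply/adjP; rewrite adjZ adjD adjK addrC. Qed.

Section Ball.
Variables (p : nat) (n : 'I_p -> nat) (j0 : 'I_p) (k : nat).
Hypothesis hn : forall j, (0 < n j)%N.
Hypothesis hk : (\prod_(j | j != j0) n j ^ 2 <= k)%N.

(** Near [M0] each slice of M - M0 is small against [kappa] times the identity, so all factors at
    [j0] stay positive with positive trace. *)
Lemma Sigma_k_ball : exists (M0 : 'M[C]_(Ndim n)) (delta : R),
  [/\ tau1 R _ M0, 0 < delta & forall M, tau1 R _ M ->
     (forall a b, `|M a b - M0 a b| <= realC delta) -> Sigma_k R n k M].
Proof.
pose P : pred (choices n) := pinned j0 hn.
pose c (j : 'I_p) (t : pair_idx n j) : pair_idx n j -> C :=
  sval (cid (@span_dm_span R _ (delta_mx t.1 t.2))).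
have cE j (t : pair_idx n j) : delta_mx t.1 t.2 = \sum_s c j t s *: span_dm s.
  exact: svalP (cid (@span_dm_span R _ (delta_mx t.1 t.2))).
have m0 : (0 < #|P|)%N.
  by rewrite card_pinned prodn_gt0 // => j; rewrite expn_gt0 hn.
have m0R : 0 < #|P|%:R :> R by rewrite ltr0n.
have w0 : 0 < (n j0)%:R :> R by rewrite ltr0n.
(* Normalizes [M0], a sum of [#|P|] terms of trace [kappa * n j0], to trace 1. *)
pose kappa : R := (#|P|%:R * (n j0)%:R)^-1.
have kappa0 : 0 < kappa by rewrite invr_gt0 mulr_gt0.
(* Bounds the slice maps: if the entries of X are at most eps/(K+1), those of its slices are at most
   eps. *)
pose Kc : C := \sum_(f : choices n) \sum_a \sum_b `|coef j0 c f a b|.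
have Kc0 : 0 <= Kc by do 3!(apply: sumr_ge0 => ? _).
pose K := complex.Re Kc.
have KcE : Kc = realC K by exact: realC_Re.
have K0 : 0 <= K by rewrite -realC_ge0 -KcE.
(* A perturbation with entries up to [eps] uses up only half of [kappa]. *)
pose eps := kappa / 2 / (n j0)%:R.
have eps0 : 0 < eps by rewrite !divr_gt0.
pose I0 (j : 'I_p) : 'M[C]_(n j) := realC kappa *: 1%:M.
pose M0 := \sum_(f in P) tens j0 f I0.
have tI0 : \tr (I0 j0) = realC (kappa * (n j0)%:R).
  rewrite mxtraceZ mxtrace1 realCM; congr (_ * _).
  by rewrite -(rmorph_nat (real_complex R)).
exists M0, (eps / (K + 1)).
have hM0 : adj M0 = M0.
  rewrite adj_sum; apply: eq_bigr => f _; rewrite -tens_adj; congr (tens j0 f _).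
  by apply: functional_extensionality_dep => j; rewrite adjZ adj1.
have tM0 : \tr M0 = 1.
  rewrite (raddf_sum (@mxtrace _ _)) /=.
  under eq_bigr do rewrite tens_trace tI0.
  rewrite -realC_sum sumr_const -mulr_natl; congr realC.
  by rewrite /kappa; field; rewrite !gt_eqF.
split; first by split=> //; apply/adjP.
  by rewrite divr_gt0 // ltr_wpDl.
move=> M [hM tM] MM0; pose X := M - M0.
have hX : adj X = X.
  have /adjP hM0' := hM0.
  by apply/matrixP => i j; rewrite !mxE rmorphB /= -hM -hM0'.
pose S f j := slice j0 c X f j.
have Sle f i i' : `|S f j0 i i'| <= realC eps.
  apply: (@le_trans _ _ (realC (eps / (K + 1)) * Kc)); last first.
    rewrite KcE -realCM lecE /= eqxx /= -mulrA ler_piMr ?(ltW eps0) //.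
    by rewrite mulrC ler_pdivrMr ?mul1r ?lerDl // ltr_wpDl.
  rewrite mxE /Kc (bigD1 f) //= mulrDr ler_wpDr //.
    apply: mulr_ge0; last by do 3!(apply: sumr_ge0 => ? _).
    by rewrite realC_ge0 divr_ge0 ?(ltW eps0) ?addr_ge0.
  rewrite mulr_sumr; apply: le_trans (ler_norm_sum _ _ _) _; apply: ler_sum => a _.
  rewrite mulr_sumr; apply: le_trans (ler_norm_sum _ _ _) _; apply: ler_sum => b _.
  rewrite !normrM; apply: (@le_trans _ _ (`|X a b| * `|coef j0 c f a b|)).
    rewrite ler_piMr ?mulr_ge0 //.
    by case: (_ && _); rewrite ?normr1 ?normr0 ?ler01.
  by rewrite ler_wpM2r // !mxE; exact: MM0.
(* The coefficients [c] are arbitrary, so a slice of a Hermitian matrix may fail to be Hermitian.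
   Its Hermitian part gives the same total, because X and all B_f are self-adjoint. *)
pose H f j : 'M[C]_(n j) := realC 2^-1 *: (S f j + adj (S f j)).
have Hle f i i' : `|H f j0 i i'| <= realC eps.
  have -> : H f j0 i i' = realC 2^-1 * (S f j0 i i' + (S f j0 i' i)^*) by rewrite !mxE.
  rewrite normrM.
  have -> : realC eps = `|realC 2^-1 : C| * (realC eps + realC eps).
    rewrite ger0_norm ?realC_ge0 // -realCD -realCM; congr realC.
    by field.
  by rewrite ler_wpM2l // (le_trans (ler_normD _ _)) // norm_conjC lerD.
pose G f j := I0 j + H f j.
have ME : M = \sum_(f in P) tens j0 f (G f).
  have SX : X = \sum_(f in P) tens j0 f (S f) by exact: slice_sum.
  rewrite (eq_bigr (fun f => tens j0 f I0 +
    realC 2^-1 *: (tens j0 f (S f) + adj (tens j0 f (S f))))); last first.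
    by move=> f _; rewrite -tens_adj -tensD -tensZ -tensD.
  rewrite big_split /= -scaler_sumr big_split /= -adj_sum -SX hX.
  have half (Y : 'M[C]_(Ndim n)) : realC 2^-1 *: (Y + Y) = Y; last by rewrite half addrC subrK.
  apply/matrixP => a b; rewrite !mxE; case: (Y a b) => x y.
  by apply/eqP; rewrite eq_complex /=; apply/andP; split; apply/eqP; field.
(* Half of the identity term already gives a positive semi-definite matrix; the other half makes the
   trace strictly positive. *)
pose H' f j := realC (kappa / 2) *: 1%:M + H f j.
have pH' f : psd R (H' f j0).
  apply: (@psd_perturbation R _ _ eps) => //; first exact: hermitian_part.
  by rewrite /eps mulrC divfK ?gt_eqF.
have tG f : \tr (G f j0) = realC (kappa / 2 * (n j0)%:R) + \tr (H' f j0).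
  rewrite !mxtraceD addrA; congr (_ + _); rewrite !mxtraceZ mxtrace1.
  have -> : (n j0)%:R = realC (n j0)%:R :> C by rewrite -(rmorph_nat (real_complex R)).
  by rewrite -!realCM -realCD; congr realC; field.
have tG0 f : 0 < complex.Re (\tr (G f j0)).
  have := psd_trace_ge0 (pH' f); rewrite tG lecE => /andP[_ h].
  by rewrite ReD /= ltr_wpDr // !mulr_gt0 // invr_gt0.
rewrite ME; apply: (@tensor_convex_comb R p n j0 hn k G (fun f => complex.Re (\tr (G f j0)))).
- by rewrite card_pinned.
- move=> f _; split => //.
  + by apply/adjP; rewrite adjD adjZ adj1; congr (_ + _); apply/adjP; exact: hermitian_part.
  + apply: (@psd_perturbation R _ _ eps) => //; first exact: hermitian_part.
    by rewrite /eps mulrC divfK ?gt_eqF //; lra.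
  + apply: realC_Re; rewrite tG addr_ge0 ?psd_trace_ge0 // realC_ge0.
    by rewrite !mulr_ge0 ?invr_ge0 // ltW.
- rewrite -Re_sum (eq_bigr (fun f => \tr (tens j0 f (G f)))) => [|f _].
    rewrite (_ : \sum_(f in P) _ = \tr M); first by rewrite tM.
    by rewrite ME (raddf_sum (@mxtrace _ _)).
  by rewrite tens_trace.
Qed.

End Ball.

(** An affine chart is Lipschitz, so it maps a small cube with corner at the coordinates of [M0]
    into the ball, and a cube is not null. *)
Lemma tau1_positive_ball w (M0 : 'M[C]_w) (delta : R) (S : set 'M[C]_w) :
  tau1 R _ M0 -> 0 < delta ->
  (forall M, tau1 R _ M -> (forall a b, `|M a b - M0 a b| <= realC delta) -> S M) ->
  tau1_positive R S.
Proof.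
move=> tM0 d0 HS phi [[A [E phiE]] [_ im]].
have [x0 _ x0E] : (phi @` setT) M0 by rewrite im.
pose Kc : C := \sum_i \sum_a \sum_b `|E i a b|.
have Kc0 : 0 <= Kc by do 3!(apply: sumr_ge0 => ? _).
pose K := complex.Re Kc.
have KcE : Kc = realC K by exact: realC_Re.
have K0 : 0 <= K by rewrite -realC_ge0 -KcE.
pose s := delta / (K + 1).
have s0 : 0 < s by rewrite divr_gt0 // ltr_wpDl.
move=> nul; apply: (@cube_not_null _ _ x0 s s0).
apply: lebesgue_null_subset nul => x xc; apply: HS.
  by rewrite -im; exists x.
move=> a b; rewrite -x0E !phiE !mxE opprD addrACA subrr add0r.
rewrite !summxE -sumrB.
apply: (@le_trans _ _ (realC s * Kc)); last first.
  rewrite KcE -realCM lecE /= eqxx /= /s -mulrA ler_piMr ?(ltW d0) //.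
  by rewrite mulrC ler_pdivrMr ?mul1r ?lerDl // ltr_wpDl.
apply: le_trans (ler_norm_sum _ _ _) _; rewrite mulr_sumr; apply: ler_sum => i _.
rewrite !mxE -mulrBl -realCB normrM ler_pM //.
  have /andP[h1 h2] := xc i.
  by rewrite ger0_norm ?realC_ge0 ?subr_ge0 // lecE /= eqxx /=; lra.
rewrite (bigD1 a) //= (bigD1 b) //= -addrA lerDl addr_ge0 //.
  by apply: sumr_ge0.
by do 2!(apply: sumr_ge0 => ? _).
Qed.

Lemma entry_ball_open w (M0 : 'M[C]_w) (delta : R) :
  open [set M : 'M[C]_w | forall a b, `|M a b - M0 a b| < realC delta].
Proof.
rewrite openE => M HM.
exists (fun a b => [set z | `|z - M0 a b| < realC delta]); last by move=> N HN a b; exact: HN.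
move=> a b; apply/nbhs_ballP; exists (realC delta - `|M a b - M0 a b|).
  by rewrite /= subr_gt0; exact: HM.
move=> z; rewrite /ball /= => hz.
rewrite (_ : z - M0 a b = (M a b - M0 a b) - (M a b - z)); last by ring.
apply: le_lt_trans (ler_normB _ _) _.
by rewrite addrC -ltrBrDr.
Qed.

End InteriorPoint.

(** * Hausdorff separation and assembly of the three statements *)

Lemma mx_complex_hausdorff (R : realType) w : hausdorff_space 'M[R[i]]_w.
Proof.
rewrite open_hausdorff => x y xy.
have [a [b ab]] : exists a b, x a b != y a b.
  apply: contrapT => H; move/eqP: xy; apply; apply/matrixP => a b.
  by apply/eqP; apply: contraPT H => ab H; apply: H; exists a, b.
(* Entrywise balls of radius d/2 around the two matrices are disjoint by the triangle inequality in
   this entry. *)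
pose d := complex.Re `|x a b - y a b|.
have dE : `|x a b - y a b| = realC d by exact: realC_Re.
have d0 : 0 < d.
  have : 0 < `|x a b - y a b| by rewrite normr_gt0 subr_eq0.
  by rewrite dE ltcE => /andP[].
have ball0 (z : 'M[R[i]]_w) : [set M : 'M[R[i]]_w | forall i j, `|M i j - z i j| < realC (d / 2)] z.
  by move=> i j; rewrite subrr normr0 ltcE /= eqxx divr_gt0.
exists ([set M : 'M[R[i]]_w | forall i j, `|M i j - x i j| < realC (d / 2)],
        [set M : 'M[R[i]]_w | forall i j, `|M i j - y i j| < realC (d / 2)]) => /=.
  by split; rewrite inE.
split; [exact: entry_ball_open|exact: entry_ball_open|].
apply/eqP/seteqP; split=> // z [/(_ a b) zx /(_ a b) zy].
have half : realC (d / 2) + realC (d / 2) = `|x a b - y a b|.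
  by rewrite dE [in RHS](splitr d) realCD.
have := ltrD zx zy; rewrite half (distrC _ (x a b)) => h.
have := le_lt_trans (ler_normD (x a b - z a b) (z a b - y a b)) h.
by rewrite addrA subrK ltxx.
Qed.

Theorem theorem2 (R : realType) (p : nat) (n : 'I_p -> nat) (k : nat)
  (hp : (1 <= p)%N) (hn : forall j, (0 < n j)%N) (hk : (0 < k)%N) :
  (* (a) *)
  ([/\ Sigma_k R n k `<=` Sigma R n,
       compact (Sigma_k R n k) &
       connected (Sigma_k R n k)] /\
   (Sigma_k R n k <> Sigma R n ->
      ~ (Sigma R n `<=` closure (Sigma_k R n k)) /\
      exists U : set 'M[R[i]]_(Ndim n),
        open U /\ Sigma R n `\` Sigma_k R n k = Sigma R n `&` U)) /\
  (* (b) *)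
  ((k%:R : R) < (\prod_(j : 'I_p) (n j ^ 2)%N)%:R
                 / (1 - p%:R + \sum_(j : 'I_p) (n j ^ 2)%N%:R) ->
     tau1_null R (Sigma_k R n k)) /\
  (* (c) *)
  ((forall i j : 'I_p, (i <= j)%N -> (n i <= n j)%N) ->
   (\prod_(j : 'I_p | (j < p.-1)%N) (n j ^ 2) <= k)%N ->
     tau1_positive R (Sigma_k R n k) /\
     exists U : set 'M[R[i]]_(Ndim n),
       tau1_open R U /\ U !=set0 /\ U `<=` Sigma_k R n k).
Proof.
case: k hk => // k' _; set k := k'.+1.
have sub : Sigma_k R n k `<=` Sigma R n by move=> M [m [_ Mm]]; exists m.
have cpt : compact (Sigma_k R n k) by exact: Sigma_k_compact.
(* Closedness gives the rest of (a): a dense closed subset is everything, and the complement is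
   open. *)
have cl : closed (Sigma_k R n k).
  by apply: compact_closed cpt; exact: mx_complex_hausdorff.
split; first split.
- by split=> //; exact: Sigma_k_connected.
- move=> neq; split.
    move=> dense; apply: neq; apply/seteqP; split=> //.
    by move/closure_id: cl => cl; rewrite {2}cl in dense *.
  exists (~` Sigma_k R n k); split; first exact: closed_openC.
  by rewrite setDE.
split.
- move=> /(@dimension_count R p n k' hn) dim.
  rewrite /k (@Sigma_kE R p n hn k'); apply: (@tau1_null_subset _ _ _ (@mixture R p n hn k' @` unit_cube)).
    exact: image_subset (@admissible_unit_cube R p n hn k').
  apply: polynomial_image_tau1_null; first by rewrite dimpE.
  exact: mixture_cpolyfun.
- move=> _ kn; case: p n hp hn kn sub cpt cl => // p' n' _ hn' kn _ _ _.
  (* The factor singled out is the last one, so the product in the hypothesis runs exactly over the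
     other factors. *)
  have kn' : (\prod_(j | j != ord_max) n' j ^ 2 <= k)%N.
    apply: leq_trans kn; rewrite leq_eqVlt; apply/orP; left; apply/eqP.
    by apply: eq_bigl => j; rewrite -val_eqE /= ltn_neqAle -ltnS ltn_ord andbT.
  have [M0 [delta [tM0 d0 ball]]] := @Sigma_k_ball R _ _ _ _ hn' kn'.
  split; first exact: tau1_positive_ball tM0 d0 ball.
  exists (tau1 R _ `&` [set M | forall a b, `|M a b - M0 a b| < realC delta]).
  split; first by eexists; split; [exact: entry_ball_open|].
  split.
    exists M0; split=> // a b.
    by rewrite subrr normr0 ltcE /= eqxx.
  by move=> M [tM HM]; apply: ball => // a b; exact: ltW.
Qed.
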